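(* Let $k_1\in[0,N]$ and let $[x_k]=(x_0,\ldots,x_N)$ be a zero-mean nonsingular Gaussian (ZMNG) sequence of $\mathbb{R}^d$-valued random vectors. Then $[x_k]$ is $CM_L\cap[k_1,N]\text{-}CM_F$ if and only if it obeys $$x_k=G_{k,k-1}x_{k-1}+G_{k,N}x_N+e_k,\quad k\in[1,N-1],$$ $$x_N=e_N,\qquad x_0=G_{0,N}x_N+e_0,$$ for some matrices $G_{k,k-1}$, $G_{k,N}$, $G_{0,N}$ and some zero-mean white nonsingular Gaussian sequence $[e_k]$ with covariances $G_k=\mathrm{Cov}(e_k)$, such that $$G_k^{-1}G_{k,N}=G_{k+1,k}'G_{k+1}^{-1}G_{k+1,N},\quad \forall k\in[k_1+1,N-2].$$
   Context: $N$ is a positive integer and $[i,j]=\{i,i+1,\ldots,j\}$ (empty if $i>j$); $[x_k]$ denotes $(x_k)_{k\in[0,N]}$. The prime denotes matrix transposition. A sequence is zero-mean nonsingular Gaussian (ZMNG) if the stacked vector of all its terms is jointly Gaussian with zero mean and nonsingular covariance matrix. A zero-mean white nonsingular Gaussian sequence $[e_k]$ is a jointly Gaussian, zero-mean sequence whose terms are mutually uncorrelated, with each $\mathrm{Cov}(e_k)$ nonsingular. For $k_1<k_2$ and $c\in\{k_1,k_2\}$, a sequence $[x_k]$ is $[k_1,k_2]$-$CM_c$ if, for all $j<k$ in $[k_1,k_2]$, the conditional distribution of $x_k$ given $(x_{k_1},\ldots,x_j,x_c)$ equals the conditional distribution of $x_k$ given $(x_j,x_c)$ (i.e. conditioned on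 $x_c$ the sequence is Markov over $[k_1,k_2]\setminus\{c\}$). It is written $[k_1,k_2]$-$CM_F$ if $c=k_1$ and $[k_1,k_2]$-$CM_L$ if $c=k_2$. By convention every sequence is $[k_1,k_2]$-$CM_c$ when $|k_2-k_1|<3$. The interval is dropped when it is $[0,N]$: $CM_L$ means $[0,N]$-$CM_L$. A sequence is $CM_L\cap[k_1,N]$-$CM_F$ if it is both $CM_L$ and $[k_1,N]$-$CM_F$. *)

(* Defs.v *)
From HB Require Import structures.
From mathcomp Require Import all_boot all_order all_algebra.
From mathcomp Require Import all_classical all_reals all_analysis.

Set Implicit Arguments.
Unset Strict Implicit.
Unset Printing Implicit Defensive.

Import Order.TTheory GRing.Theory Num.Theory.
Import numFieldNormedType.Exports.

Local Open Scope classical_set_scope.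
Local Open Scope ring_scope.

Definition measure_matrix_display : measure_display -> measure_display.
Proof. exact. Qed.

(* The Borel structure of R^d: the sigma-algebra generated by the entries,
   as the library does for tuples. *)
Section matrix_measurable.
Context {d} {T : measurableType d} (m n : nat).

Definition entry_sets : set (set 'M[T]_(m, n)) :=
  \bigcup_(ij in [set: 'I_m * 'I_n])
    preimage_set_system setT (fun A : 'M[T]_(m, n) => A ij.1 ij.2) measurable.

Let matrix_set0 : <<s entry_sets >> set0.
Proof. exact: sigma_algebra0. Qed.

Let matrix_setC A : <<s entry_sets >> A -> <<s entry_sets >> (~` A).
Proof. exact: sigma_algebraC. Qed.

Let matrix_bigcup (F : (set 'M[T]_(m, n))^nat) :
  (forall i, <<s entry_sets >> (F i)) -> <<s entry_sets >> (\bigcup_i F i).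
Proof. exact: sigma_algebra_bigcup. Qed.

HB.instance Definition _ := @isMeasurable.Build (measure_matrix_display d)
  'M[T]_(m, n) <<s entry_sets >> matrix_set0 matrix_setC matrix_bigcup.

End matrix_measurable.

Section gaussian.
Context {R : realType} {dT : measure_display} {T : measurableType dT}.
Variable P : probability T R.

(* Q is the law of m independent standard normal variables; the product rule on
   boxes determines Q. *)
Definition std_normal_law (m : nat) (Q : probability 'cV[R]_m R) : Prop :=
  forall B : 'I_m -> set R, (forall i, measurable (B i)) ->
    Q [set z | forall i, B i (z i ord0)] =
    (\prod_(i < m) normal_prob 0 1 (B i))%E.

(* X has the law of mu + A Z with Z a standard normal vector; A is arbitrary, so
   degenerate Gaussian laws are allowed. *)
Definition gaussian (n : nat) (X : T -> 'cV[R]_n) : Prop :=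
  exists (m : nat) (Q : probability 'cV[R]_m R) (mu : 'cV[R]_n)
         (A : 'M[R]_(n, m)),
    std_normal_law Q /\
    forall B : set 'cV[R]_n, measurable B ->
      P (X @^-1` B) = Q [set z | B (mu + A *m z)].

(* Only used for Gaussian vectors, whose covariances are finite. *)
Definition cov_mx (m n : nat) (X : T -> 'cV[R]_m) (Y : T -> 'cV[R]_n) :
    'M[R]_(m, n) :=
  \matrix_(i, j)
    fine (covariance P (fun w => X w i ord0) (fun w => Y w j ord0)).

Definition zero_mean (n : nat) (X : T -> 'cV[R]_n) : Prop :=
  forall i, ('E_P[(fun w => X w i ord0)] = 0)%E.

Section sequences.
Context {N d : nat}.
Implicit Types x e : 'I_N.+1 -> {RV P >-> 'cV[R]_d}.

Definition stacked x (w : T) : 'cV[R]_(\sum_(k < N.+1) d) :=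
  \mxcol_(k < N.+1) x k w.

Definition ZMNG x : Prop :=
  [/\ gaussian (stacked x), zero_mean (stacked x) &
      cov_mx (stacked x) (stacked x) \in unitmx].

Definition white_nonsingular_gaussian e : Prop :=
  [/\ gaussian (stacked e), forall k, zero_mean (e k),
      forall j k, j != k -> cov_mx (e j) (e k) = 0 &
      forall k, cov_mx (e k) (e k) \in unitmx].

End sequences.
End gaussian.

Section conditional_distribution.
Context {R : realType} {dT : measure_display} {T : measurableType dT}.
Variable P : probability T R.

(* kappa is a regular conditional distribution of X given the sigma-algebra
   generated by G. *)
Definition is_cond_distribution (d : nat) (X : T -> 'cV[R]_d)
    (G : set (set T)) (kappa : R.-pker g_sigma_algebraType G ~> 'cV[R]_d) :
    Prop :=
  forall (C : set T) (B : set 'cV[R]_d), <<s G >> C -> measurable B ->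
    (\int[P]_(w in C) kappa w B)%E = P (C `&` X @^-1` B).

(* Regular conditional distributions on R^d exist and are unique up to a null
   set, so it does not matter which versions are compared. *)
Definition eq_cond_distribution (d : nat) (X : T -> 'cV[R]_d)
    (G1 G2 : set (set T)) : Prop :=
  exists (k1 : R.-pker g_sigma_algebraType G1 ~> 'cV[R]_d)
         (k2 : R.-pker g_sigma_algebraType G2 ~> 'cV[R]_d),
    [/\ is_cond_distribution X k1, is_cond_distribution X k2 &
        {ae P, forall w, forall B : set 'cV[R]_d, measurable B ->
           k1 w B = k2 w B}].

Context {N d : nat}.
Implicit Type x : 'I_N.+1 -> {RV P >-> 'cV[R]_d}.

(* Generators of the sigma-algebra of the variables x_i with i in S. *)
Definition generated_by x (S : set 'I_N.+1) : set (set T) :=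
  \bigcup_(i in S) g_sigma_algebra_preimage (x i).

(* x is [k1, k2]-CM_c; meant for k1 <= k2 and c \in {k1, k2}. *)
Definition CM x (k1 k2 c : 'I_N.+1) : Prop :=
  (k2 - k1 < 3)%N \/
  forall j k : 'I_N.+1, (k1 <= j)%N -> (j < k)%N -> (k <= k2)%N ->
    eq_cond_distribution (x k)
      (generated_by x [set i : 'I_N.+1 | (k1 <= i <= j)%N \/ i = c])
      (generated_by x [set i | i = j \/ i = c]).

Definition CM_F x (k1 k2 : 'I_N.+1) : Prop := CM x k1 k2 k1.
Definition CM_L x (k1 k2 : 'I_N.+1) : Prop := CM x k1 k2 k2.

End conditional_distribution.

(* Main.v *)
Require Import Defs.
From HB Require Import structures.
From mathcomp Require Import all_boot all_order all_algebra.
From mathcomp Require Import all_classical all_reals all_analysis.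
From mathcomp Require Import measurable_realfun ring lra zify.

(* Stack the sequence into one vector [X] with nonsingular covariance [C], so
   that [x_k = E_k X] for a block selector [E_k].  A Gaussian vector is an
   affine image of a standard normal one, and the standard normal law is
   invariant under plane rotations; rotating the coordinates until two
   uncorrelated linear images of [X] depend on disjoint sets of them shows that
   these images are independent.  Hence, for [S2] contained in [S1], if the error
   of the best linear predictor of [x_k] on [(x_i)_{i in S2}] is uncorrelated
   with all [x_i], [i in S1], then this error translated by the predictor gives
   the conditional law of [x_k] on both index sets.  Conversely the mean of the
   conditional law is the best linear predictor, so equal conditional laws have
   equal predictors.

   What remains is linear algebra.  If [e_k = L_k X] are the noises and [V_k]
   their covariances, then
     [D_k = V_k^-1 L_k - G_{k+1,k}^T V_{k+1}^-1 L_{k+1}]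
   is the [k]-th block row of [C^-1]: [D_k X] is uncorrelated with every [x_m],
   [m <> k].  It is a combination of [x_{k-1}, x_k, x_{k+1}, x_N], and the
   identity imposed on the coefficients says that the one of [x_N] vanishes.  A
   best predictor cannot use [x_k] if [D_k X] is a combination of the predicting
   variables, because its error is uncorrelated with [D_k X]; this gives both
   Markov properties.  Conversely, testing [D_k X] against the error of the
   predictor of [x_N] on [(x_{k1}, x_{k+1})] shows that the coefficient of [x_N]
   in [D_k X] is zero. *)

Set Implicit Arguments.
Unset Strict Implicit.
Unset Printing Implicit Defensive.

Import Order.TTheory GRing.Theory Num.Theory.
Import numFieldNormedType.Exports.

Local Open Scope classical_set_scope.
Local Open Scope ring_scope.

(** * Linear prediction from a Gram matrix *)

Section gram.
Context {R : realFieldType}.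

Lemma mulmx_tr_eq0 m n (A : 'M[R]_(m, n)) : A *m A^T = 0 -> A = 0.
Proof.
move=> AA0; apply/matrixP => i j; rewrite mxE.
have /matrixP/(_ i i) := AA0; rewrite !mxE => /eqP.
rewrite psumr_eq0 => [/allP/(_ j)|k _]; last by rewrite mxE -expr2 sqr_ge0.
by rewrite mem_index_enum mxE -expr2 sqrf_eq0 => /(_ isT)/eqP.
Qed.

Context {n q : nat} (C : 'M[R]_n) (B : 'M[R]_(n, q)).
Hypothesis CE : C = B *m B^T.

Lemma gram_sym : C^T = C.
Proof. by rewrite CE trmx_mul trmxK. Qed.

(** A Gram form is positive semidefinite: [L C L^T] is [(L B) (L B)^T], so its vanishing forces
    [L B = 0]. *)
Lemma gram_isotropic m (L : 'M[R]_(m, n)) : L *m C *m L^T = 0 -> L *m C = 0.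
Proof.
rewrite CE mulmxA -mulmxA -trmx_mul => /mulmx_tr_eq0 LB0.
by rewrite LB0 mul0mx.
Qed.

(** A row [u] killed by [L C L^T] makes [u L] isotropic for the invertible [C], hence zero; the
    right inverse [K] then gives [u = 0]. *)
Lemma gram_unitmx m (L : 'M[R]_(m, n)) (K : 'M[R]_(n, m)) :
  C \in unitmx -> L *m K = 1%:M -> L *m C *m L^T \in unitmx.
Proof.
move=> Cu LK; rewrite -row_free_unit; apply/inj_row_free => u u0.
have : (u *m L) *m C *m (u *m L)^T = 0.
  by rewrite trmx_mul mulmxA -(mulmxA u L) -(mulmxA u _ L^T) u0 mul0mx.
move=> /gram_isotropic /(congr1 (mulmx^~ (invmx C))).
rewrite mulmxK // mul0mx => /(congr1 (mulmx^~ K)).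
by rewrite -mulmxA LK mulmx1 mul0mx.
Qed.

(* Normal equations: [C W^T] vanishes on the kernel of [W C W^T]. *)
Lemma gram_projection m p (L : 'M[R]_(m, n)) (W : 'M[R]_(p, n)) :
  exists K : 'M[R]_(m, p), (L - K *m W) *m C *m W^T = 0.
Proof.
have : (L *m C *m W^T <= W *m C *m W^T)%MS.
  set D := W *m C *m W^T; rewrite submxE; set Y := cokermx D.
  have DY : D *m Y = 0 by exact: mulmx_coker.
  have : (Y^T *m W) *m C *m (Y^T *m W)^T = 0.
    rewrite [(Y^T *m W)^T]trmx_mul trmxK.
    transitivity (Y^T *m (D *m Y)); first by rewrite /D !mulmxA.
    by rewrite DY mulmx0.
  move=> /gram_isotropic /(congr1 trmx).
  rewrite trmx0 trmx_mul gram_sym trmx_mul !trmxK => CWY.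
  by rewrite -(mulmxA _ W^T) -(mulmxA L) CWY mulmx0.
by move=> /submxP[K KE]; exists K; rewrite !mulmxBl KE !mulmxA subrr.
Qed.

End gram.

(** * Predictors supported on sets of blocks *)

Section blocks.
Context {R : realFieldType} {N d n q : nat}.
Variables (E : 'I_N.+1 -> 'M[R]_(d, n)) (C : 'M[R]_n) (B : 'M[R]_(n, q)).
Hypothesis CE : C = B *m B^T.
Implicit Types (S : set 'I_N.+1) (M : 'I_N.+1 -> 'M[R]_d).

Definition combo M : 'M[R]_(d, n) := \sum_i M i *m E i.

(* The coefficients, supported on [S2], of a linear predictor of the block [k]
   whose error is uncorrelated with the blocks in [S1]. *)
Definition lin_markov (k : 'I_N.+1) S1 S2 M : Prop :=
  (forall i, ~ S2 i -> M i = 0) /\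
  (forall i, S1 i -> (E k - combo M) *m C *m (E i)^T = 0).

Definition in_span S (D : 'M[R]_(d, n)) : Prop :=
  exists2 F, forall i, ~ S i -> F i = 0 & D = combo F.

Lemma in_spanE S a i : S i -> in_span S (a *m E i).
Proof.
move=> Si; exists (fun j => if j == i then a else 0).
  by move=> j Sj; case: eqP => // ji; case: Sj; rewrite ji.
rewrite /combo (bigD1 i) //= eqxx big1 ?addr0 // => j /negbTE ->.
by rewrite mul0mx.
Qed.

Lemma in_spanB S D D' : in_span S D -> in_span S D' -> in_span S (D - D').
Proof.
move=> [F F0 ->] [F' F'0 ->]; exists (fun i => F i - F' i).
  by move=> i Si; rewrite F0 // F'0 // subr0.
by rewrite /combo -sumrB; apply: eq_bigr => i _; rewrite mulmxBl.
Qed.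

Lemma in_spanD S D D' : in_span S D -> in_span S D' -> in_span S (D + D').
Proof.
move=> [F F0 ->] [F' F'0 ->]; exists (fun i => F i + F' i).
  by move=> i Si; rewrite F0 // F'0 // addr0.
by rewrite /combo -big_split; apply: eq_bigr => i _; rewrite mulmxDl.
Qed.

Lemma in_span_combo S M : (forall i, ~ S i -> M i = 0) -> in_span S (combo M).
Proof. by move=> M0; exists M. Qed.

Lemma in_span_orth S D (L : 'M[R]_(n, d)) :
  in_span S D -> (forall i, S i -> E i *m L = 0) -> D *m L = 0.
Proof.
move=> [M M0 ->] EL; rewrite mulmx_suml big1 // => i _.
by have [/EL Ei|/M0 ->] := pselect (S i); rewrite ?mul0mx // -mulmxA Ei mulmx0.
Qed.

Hypothesis EE : forall j k, E j *m (E k)^T = (j == k)%:R%:M.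

Lemma comboE M k : combo M *m (E k)^T = M k.
Proof.
rewrite mulmx_suml (bigD1 k) //= -mulmxA EE eqxx mulmx1 big1 ?addr0 // => i ik.
by rewrite -mulmxA EE (negbTE ik) mul_mx_scalar scale0r.
Qed.

(** [W] is the orthogonal projector onto the coordinates of the blocks in [S], so a single use of
    [gram_projection] handles all these blocks, and the coefficients are read off as [K E_i^T]. *)
Lemma lin_markov_exists k S : exists M, lin_markov k S S M.
Proof.
pose W := \sum_(i | `[< S i >]) (E i)^T *m E i.
have WT : W^T = W.
  by rewrite /W raddf_sum; apply: eq_bigr => j _ /=; rewrite trmx_mul trmxK.
have WE i : S i -> W *m (E i)^T = (E i)^T.
  move=> Si; rewrite mulmx_suml (bigD1 i) /=; last exact/asboolP.
  rewrite -mulmxA EE eqxx mulmx1 big1 ?addr0 // => j /andP[_ ji].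
  by rewrite -mulmxA EE (negbTE ji) mul_mx_scalar scale0r.
have [K KW] := gram_projection CE (E k) W.
exists (fun i => if `[< S i >] then K *m (E i)^T else 0); split.
  by move=> i /asboolPn/negbTE ->.
move=> i Si; have -> : combo (fun i => if `[< S i >] then K *m (E i)^T else 0) =
    K *m W.
  rewrite /combo /W mulmx_sumr [RHS]big_mkcond; apply: eq_bigr => j _.
  by case: ifP => _; rewrite ?mul0mx // mulmxA.
by rewrite -(WE _ Si) mulmxA -{2}WT KW mul0mx.
Qed.

Lemma lin_markov_self k S1 S2 : S2 k -> exists M, lin_markov k S1 S2 M.
Proof.
move=> Sk; exists (fun i => (i == k)%:R%:M); split.
  by move=> i Si; case: eqP => [ik|_]; [case: Si; rewrite ik|exact: raddf0].
move=> i _; rewrite /combo (bigD1 k) //= eqxx mul1mx big1 ?addr0 ?subrr ?mul0mx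
  //.
by move=> j /negbTE ->; rewrite mul_scalar_mx scale0r.
Qed.

(* Testing the error of the best predictor on [S1] against a combination of the
   blocks in [S1] dual to the block [i] shows that its [i]-th coefficient
   vanishes. *)
Lemma lin_markov_dual k S1 S2 :
  (forall i, S1 i -> ~ S2 i ->
     exists D, [/\ in_span S1 D, D *m C *m (E k)^T = 0 &
                   forall l, S1 l -> D *m C *m (E l)^T = (i == l)%:R%:M]) ->
  exists M, lin_markov k S1 S2 M.
Proof.
move=> dual; have [M [M0 MC]] := lin_markov_exists k S1.
exists M; split => // i S2i.
have [S1i|] := pselect (S1 i); last exact: M0.
have [D [DS DC DM]] := dual i S1i S2i.
have CT := gram_sym CE.
have : D *m (C *m (E k - combo M)^T) = 0.
  apply: (in_span_orth DS) => l /MC /(congr1 trmx).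
  by rewrite trmx0 2!trmx_mul CT trmxK.
rewrite raddfB /= mulmxBr mulmxBr !mulmxA DC sub0r => /eqP.
rewrite oppr_eq0 raddf_sum mulmx_sumr (bigD1 i) //= big1 ?addr0 => [|l li].
  rewrite trmx_mul mulmxA DM // eqxx mul1mx => /eqP/(congr1 trmx).
  by rewrite trmx0 trmxK.
have [S1l|/M0 ->] := pselect (S1 l); last by rewrite mul0mx trmx0 mulmx0.
by rewrite trmx_mul mulmxA DM // eq_sym (negbTE li) mul_scalar_mx scale0r.
Qed.

End blocks.

(** * The recursion driven by white noise *)

Section model.
Context {R : realFieldType} {N d n q : nat} (N_gt0 : (0 < N)%N).
Variables (E : 'I_N.+1 -> 'M[R]_(d, n)) (C : 'M[R]_n) (B : 'M[R]_(n, q)).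
Hypothesis EE : forall j k, E j *m (E k)^T = (j == k)%:R%:M.
Hypothesis CE : C = B *m B^T.
Implicit Types (G : 'I_N.+1 -> 'I_N.+1 -> 'M[R]_d) (L : 'I_N.+1 -> 'M[R]_(d,
  n)).

Definition past (k1 c j : 'I_N.+1) : set 'I_N.+1 :=
  [set i : 'I_N.+1 | (k1 <= i <= j)%N \/ i = c].

Definition present (c j : 'I_N.+1) : set 'I_N.+1 := [set i | i = j \/ i = c].

(** Both Markov properties of the theorem correspond to instances: [k1 = 0] with [c = N], and
    [c = k1]. *)
Definition lin_CM (k1 c : 'I_N.+1) : Prop :=
  forall j k : 'I_N.+1, (k1 <= j)%N -> (j < k)%N ->
    exists M, lin_markov E C k (past k1 c j) (present c j) M.

Definition model G L : Prop :=
  [/\ forall j k : 'I_N.+1, k = j.+1 :> nat -> (k < N)%N ->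
        E k = G k j *m E j + G k ord_max *m E ord_max + L k,
      E ord_max = L ord_max &
      E ord0 = G ord0 ord_max *m E ord_max + L ord0].

Definition white L : Prop :=
  (forall j k, j != k -> L j *m C *m (L k)^T = 0) /\
  (forall k, L k *m C *m (L k)^T \in unitmx).

Definition balanced (k1 : 'I_N.+1) G L : Prop :=
  forall k l : 'I_N.+1, (k1 < k)%N -> l = k.+1 :> nat -> (l < N)%N ->
    invmx (L k *m C *m (L k)^T) *m G k ord_max =
    (G l k)^T *m invmx (L l *m C *m (L l)^T) *m G l ord_max.

Section dual.
Variables (G : 'I_N.+1 -> 'I_N.+1 -> 'M[R]_d) (L : 'I_N.+1 -> 'M[R]_(d, n)).
Hypotheses (GL : model G L) (Lw : white L).
Local Notation V k := (L k *m C *m (L k)^T).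

(* The [k]-th block row of the inverse of [C]. *)
Definition dual (k l : 'I_N.+1) : 'M[R]_(d, n) :=
  invmx (V k) *m L k - (G l k)^T *m invmx (V l) *m L l.

Lemma dual_noise (k l m : 'I_N.+1) :
  dual k l *m C *m (L m)^T = (k == m)%:R%:M - (l == m)%:R *: (G l k)^T.
Proof.
have [Lorth Vu] := Lw.
pose iV j := invmx (V j).
have VL (j : 'I_N.+1) : iV j *m (L j *m (C *m (L m)^T)) = (j == m)%:R%:M.
  rewrite (mulmxA (L j)) /iV; have [->|jm] := eqVneq j m;
    first by rewrite mulVmx.
  by rewrite (Lorth _ _ jm) mulmx0 raddf0.
rewrite /dual -/(iV k) -/(iV l) 2!mulmxBl -!mulmxA !VL.
by rewrite mul_mx_scalar.
Qed.

(** Induction on [m] along the recursion. At [m = k] the noise [L_k] contributes the identity; at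
    [m = l] the term [G_{l,k}^T] inherited from [E_k] cancels the one coming from [L_l]. *)
Lemma dual_orth (k l m : 'I_N.+1) : l = k.+1 :> nat -> (l < N)%N ->
  dual k l *m C *m (E m)^T = (k == m)%:R%:M.
Proof.
move=> lk lN; have [rec recN rec0] := GL.
have kN : (k < N)%N by apply: ltn_trans lN; rewrite lk.
(* The last block is itself a noise, and its index differs from [k] and [l], which are both below
   [N]. *)
have EN : dual k l *m C *m (E ord_max)^T = 0.
  rewrite recN dual_noise; have -> : (k == ord_max) = false.
    by apply/eqP => /(congr1 val) /= kE; rewrite kE ltnn in kN.
  have -> : (l == ord_max) = false.
    by apply/eqP => /(congr1 val) /= lE; rewrite lE ltnn in lN.
  by rewrite raddf0 scale0r subr0.
case: (ltngtP m N) => [mN||mN]; last first.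
- have -> : m = ord_max by apply/val_inj.
  rewrite EN; case: eqP => [kE|_]; last by rewrite raddf0.
  by move: kN; rewrite kE ltnn.
- by move=> Nm; have := ltn_ord m; rewrite ltnS leqNgt Nm.
case: m mN => m m1 /=; elim: m m1 => [|m IHm] m1 mN.
  have -> : Ordinal m1 = ord0 by apply/val_inj.
  rewrite rec0 raddfD /= mulmxDr trmx_mul mulmxA EN mul0mx add0r dual_noise.
  have -> : (l == ord0) = false by apply/eqP => /(congr1 val) /=; rewrite lk.
  by rewrite scale0r subr0.
have m1' := ltnW m1.
rewrite (rec (Ordinal m1')) // !raddfD /= ?mulmxDr !trmx_mul !mulmxA EN mul0mx.
rewrite addr0 IHm ?(ltnW mN) // dual_noise.
have -> : (l == Ordinal m1) = (k == Ordinal m1') by rewrite -!val_eqE /= lk.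
case: eqP => [km|_]; last by rewrite raddf0 mul0mx scale0r add0r subr0.
rewrite mul1mx scale1r addrC -addrA.
have -> : Ordinal m1 = l by apply/val_inj; rewrite /= lk km.
rewrite -km addNr addr0; case: eqP => [/(congr1 val) /=|_];
  last by rewrite raddf0.
by rewrite lk => /n_Sn.
Qed.

(** Solve the recursion for the two noises. Only the coefficient of [E_N] is kept explicit: up to
    sign, it is the difference of the two sides of [balanced]. *)
Lemma dual_combo (k l : 'I_N.+1) : l = k.+1 :> nat -> (l < N)%N ->
  exists a b c, dual k l = a *m E (inord k.-1) + b *m E k + c *m E l
    - (invmx (V k) *m G k ord_max -
       (G l k)^T *m invmx (V l) *m G l ord_max) *m E ord_max.
Proof.
move=> lk lN; have [rec recN rec0] := GL.
have kN : (k < N)%N by apply: ltn_trans lN; rewrite lk.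
have Ll : L l = E l - G l k *m E k - G l ord_max *m E ord_max.
  by rewrite (rec k l) // -addrA -opprD addrC addKr.
have [a Lk] : exists a, L k = E k - a *m E (inord k.-1) - G k ord_max *m E
  ord_max.
  case: (posnP k) => [k0|k_gt0].
    (* The block 0 has no predecessor; [k.-1] is then 0 and receives a zero coefficient. *)
    exists 0; rewrite mul0mx subr0; have -> : k = ord0 by apply/val_inj.
    by rewrite rec0 addrC addKr.
  exists (G k (inord k.-1)); set j := inord _.
  have kj : k = j.+1 :> nat by rewrite /j inordK prednK // ltnW.
  by rewrite (rec j k) // -addrA -opprD addrC addKr.
exists (- (invmx (V k) *m a)), (invmx (V k) + (G l k)^T *m invmx (V l) *m G l
  k).
exists (- ((G l k)^T *m invmx (V l))).
rewrite /dual; move: (invmx (V k)) (_ *m invmx (V l)) => U W; rewrite Lk Ll.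
rewrite !mulmxBr !mulmxBl !mulmxDl !mulNmx !mulmxA !opprD !opprK.
by rewrite [LHS](AC (3*3) ((2*(1*5))*4*(3*6))).
Qed.

(** A past index [i] outside the present satisfies [k1 <= i < j] and [i != c]. As [i < k], the row
    [dual i l] with [l = i + 1] is orthogonal to the target [k] and serves as the test in
    [lin_markov_dual]. *)
Lemma lin_CM_dual (k1 c : 'I_N.+1) :
  (forall j k l : 'I_N.+1, (k1 <= k)%N -> k != c -> l = k.+1 :> nat ->
     (l <= j)%N -> (l < N)%N -> in_span E (past k1 c j) (dual k l)) ->
  lin_CM k1 c.
Proof.
move=> dualS j k k1j jk; apply: (lin_markov_dual CE EE) => i Pi NPi.
have ic : i != c by apply/eqP => ic; apply: NPi; right.
have ij : i != j by apply/eqP => ij; apply: NPi; left.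
have [/andP[k1i i_le_j]|/eqP] := Pi; last by rewrite (negbTE ic).
have i_lt_j : (i < j)%N by rewrite ltn_neqAle i_le_j andbT.
have kN : (k <= N)%N by rewrite -ltnS.
pose l : 'I_N.+1 := inord i.+1.
have li : l = i.+1 :> nat.
  by rewrite inordK // ltnS (leq_trans i_lt_j) // (leq_trans (ltnW jk)).
have lj : (l <= j)%N by rewrite li.
have lN : (l < N)%N by rewrite (leq_ltn_trans lj) // (leq_trans jk).
exists (dual i l); split; first exact: dualS.
  rewrite dual_orth //; case: eqP => [ik|_]; last by rewrite raddf0.
  by move: (ltn_trans i_lt_j jk); rewrite ik ltnn.
by move=> m _; rewrite dual_orth.
Qed.

(** Here [x_N] is a conditioning variable, so all four blocks of [dual_combo] lie in the past. *)
Lemma model_lin_CM_L : lin_CM ord0 ord_max.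
Proof.
apply: lin_CM_dual => j k l _ _ lk lj lN.
have [a [b [c ->]]] := dual_combo lk lN.
have kj : (k < j)%N by rewrite -lk.
apply: in_spanB; last by apply: in_spanE; right.
apply: in_spanD; last by apply: in_spanE; left.
apply: in_spanD; apply: in_spanE; left; last exact: ltnW.
rewrite inordK; last by rewrite (leq_ltn_trans (leq_pred _)).
exact: leq_trans (leq_pred _) (ltnW kj).
Qed.

(** Balance removes the block [N], and [k != k1] gives [k1 <= k - 1], so the other three blocks lie
    in the past. *)
Lemma model_lin_CM_F (k1 : 'I_N.+1) : balanced k1 G L -> lin_CM k1 k1.
Proof.
move=> Gb; apply: lin_CM_dual => j k l k1k kk1 lk lj lN.
have {kk1}k1k : (k1 < k)%N by rewrite ltn_neqAle k1k andbT eq_sym.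
have [a [b [c ->]]] := dual_combo lk lN.
have kj : (k < j)%N by rewrite -lk.
rewrite (Gb k l) // subrr mul0mx subr0.
apply: in_spanD; last by apply: in_spanE; left; rewrite /= lj andbT lk;
  exact/ltnW/ltnW.
apply: in_spanD; apply: in_spanE; left => /=;
  last by rewrite (ltnW k1k) (ltnW kj).
rewrite inordK; last by rewrite (leq_ltn_trans (leq_pred _)).
rewrite (leq_trans (leq_pred _) (ltnW kj)) andbT.
by rewrite -ltnS prednK // (leq_ltn_trans _ k1k).
Qed.

End dual.

(** The first Markov property supplies the coefficients, as those of best predictors, and the
    noises, as their errors; the second one supplies the balance. *)
Lemma lin_CM_model (k1 : 'I_N.+1) : C \in unitmx ->
  lin_CM ord0 ord_max -> lin_CM k1 k1 ->
  exists G L, [/\ model G L, white L & balanced k1 G L].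
Proof.
move=> Cu CML CMF.
pose S (k : 'I_N.+1) : set 'I_N.+1 := [set i : 'I_N.+1 | (i < k)%N \/ i =
  ord_max].
(* At [k = 0] no index satisfies [i.+1 = k], so the support reduces to [N] and the initial equation
   is covered too. *)
have [G GP] : exists G : 'I_N.+1 -> 'I_N.+1 -> 'M[R]_d, forall k : 'I_N.+1,
    (k < N)%N -> lin_markov E C k (S k) [set i : 'I_N.+1 | i.+1 =
      k :> nat \/ i = ord_max] (G k).
  suff /choice[G GP] : forall k : 'I_N.+1, exists M, (k < N)%N ->
      lin_markov E C k (S k) [set i : 'I_N.+1 | i.+1 = k :> nat \/ i =
        ord_max] M by exists G.
  move=> k; have [k0|k_gt0] := posnP k.
    have [M [M0 MC]] := lin_markov_exists CE EE k [set ord_max].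
    exists M => _; split => [i iP|i [|->]]; [|by rewrite k0|exact: MC].
    by apply: M0 => iN; apply: iP; right.
  pose j : 'I_N.+1 := inord k.-1.
  have kj : k = j.+1 :> nat by rewrite /j inordK prednK // ltnW.
  have [|M [M0 MC]] := CML j k (leq0n _); first by rewrite kj.
  exists M => _; split => [i iP|i [ik|->]].
  - apply: M0 => -[ij|iN]; apply: iP; [left|by right].
    by rewrite ij -kj.
  - by apply: MC; left; rewrite /= -ltnS -kj.
  - by apply: MC; right.
pose L (k : 'I_N.+1) : 'M[R]_(d, n) := if (k < N)%N then E k - combo E (G k)
  else E k.
have neN (k : 'I_N.+1) : (k < N)%N -> k != ord_max.
  by move=> kN; apply/eqP => kE; rewrite kE ltnn in kN.
have LP (k i : 'I_N.+1) : (k < N)%N -> S k i -> L k *m C *m (E i)^T = 0.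
  by move=> kN /(GP k kN).2; rewrite /L kN.
have Lspan (k : 'I_N.+1) : in_span E [set i : 'I_N.+1 | (i <= k)%N \/ i =
  ord_max] (L k).
  have Ek : in_span E [set i : 'I_N.+1 | (i <= k)%N \/ i = ord_max] (E k).
    by rewrite -[E k]mul1mx; apply: in_spanE; left => /=.
  rewrite /L; case: ifP => // kN; apply: in_spanB => //;
    apply: in_span_combo => i iP.
  apply: (GP k kN).1 => -[ik|iN]; apply: iP; [left|by right].
  by rewrite /= -ik.
have Ltr j k : (L j *m C *m (L k)^T)^T = L k *m C *m (L j)^T.
  by rewrite 2!trmx_mul trmxK (gram_sym CE) mulmxA.
(* The error [L_k] is uncorrelated with all earlier blocks and with the block [N]; [L_j] is a
   combination of such blocks. *)
have Llt (j k : 'I_N.+1) : (k < N)%N -> (j < k)%N \/ j = ord_max ->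
    L k *m C *m (L j)^T = 0.
  move=> kN jk; rewrite -Ltr -mulmxA [X in X^T](_ : _ = 0) ?trmx0 //.
  have LPt i : S k i -> E i *m (C *m (L k)^T) = 0.
    move=> ki; rewrite -[E _]trmxK -(gram_sym CE) -!trmx_mul LP //.
    by rewrite trmx0.
  case: jk => [jk|->]; last by rewrite {1}/L ltnn LPt //; right.
  apply: (in_span_orth (Lspan j)) => i ij; apply: LPt.
  by case: ij => [ij|->]; [left; exact: leq_ltn_trans jk|right].
(* [L_k] has coefficient 1 on [E_k]; the right inverse obtained here makes the noise covariance
   nonsingular. *)
have LE k : L k *m (E k)^T = 1%:M.
  rewrite /L; case: ifP => kN; last by rewrite EE eqxx.
  rewrite mulmxBl EE eqxx comboE // (GP k kN).1 ?subr0 // => -[/esym/n_Sn//|kE].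
  by have := neN _ kN; rewrite kE eqxx.
have Lw : white L.
  split=> [j k jk|k]; last exact: (gram_unitmx CE Cu (LE k)).
  have [kN|Nk] := ltnP k N; last first.
    have kE : k = ord_max by apply/val_inj/eqP;
      rewrite eqn_leq Nk -ltnS ltn_ord.
    have jN : (j < N)%N.
      rewrite ltn_neqAle -ltnS ltn_ord andbT; apply: contra jk => /eqP jN.
      by rewrite kE; apply/eqP/val_inj.
    by rewrite Llt //; right.
  have [jk'|kj] := ltnP j k; first by rewrite -Ltr Llt ?trmx0 //; left.
  have kj' : (k < j)%N by rewrite ltn_neqAle kj andbT eq_sym.
  have [jN|Nj] := ltnP j N; first by rewrite Llt //; left.
  rewrite -Ltr Llt ?trmx0 //; right.
  by apply/val_inj/eqP; rewrite eqn_leq Nj -ltnS ltn_ord.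
have GL : model G L.
  split=> [j k kj kN||].
  - have jN : (j < N)%N by rewrite ltnW // -kj.
    have [G0 _] := GP k kN.
    rewrite /L kN addrC -[LHS](subrK (combo E (G k))); congr (_ + _).
    rewrite /combo (bigD1 j) //= (bigD1 ord_max) ?(eq_sym ord_max) ?neN //=.
    rewrite big1 ?addr0 // => i /andP[ij iN].
    rewrite G0 ?mul0mx // => -[ik|iE]; last by rewrite iE eqxx in iN.
    by case/eqP: ij; apply/val_inj; apply: succn_inj; rewrite ik kj.
  - by rewrite /L ltnn.
  - have [G0 _] := GP ord0 N_gt0.
    rewrite /L N_gt0 addrC -[LHS](subrK (combo E (G ord0))); congr (_ + _).
    rewrite /combo (bigD1 ord_max) //= big1 ?addr0 // => i iN.
    by rewrite G0 ?mul0mx // => -[//|iE]; rewrite iE eqxx in iN.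
exists G, L; split=> // k l k1k lk lN.
have kN : (k < N)%N by rewrite ltnW // -lk.
have kl : (k < l)%N by rewrite lk.
(* Predict [x_N] from [x_{k1}] and [x_l]; the error [r] is uncorrelated with all of
   [x_{k1}, ..., x_l]. *)
have [M [M0 MC]] := CMF l ord_max (ltnW (ltn_trans k1k kl)) lN.
pose r := E ord_max - combo E M.
have MCt i : past k1 k1 l i -> E i *m (C *m r^T) = 0.
  by move=> /MC rE; rewrite -[E _]trmxK -(gram_sym CE) -!trmx_mul rE trmx0.
(* The prediction is orthogonal to its own error, so the covariance of [x_N] with [r] is that of
   [r], which is invertible. *)
have rr : E ord_max *m (C *m r^T) = r *m C *m r^T.
  rewrite -[RHS]mulmxA {2}/r mulmxBl [X in _ = _ - X](_ : _ = 0) ?subr0 //.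
  apply: (in_span_orth (in_span_combo E M0)) => i [->|->]; apply: MCt;
    last by right.
  by left; rewrite leqnn andbT (ltnW (ltn_trans k1k kl)).
have ru : r *m C *m r^T \in unitmx.
  apply: (gram_unitmx CE Cu (K := (E ord_max)^T)).
  rewrite mulmxBl EE eqxx comboE // M0 ?subr0 // => -[lE|k1E].
    by have := neN _ lN; rewrite -lE eqxx.
  by have := neN _ (ltn_trans k1k kN); rewrite -k1E eqxx.
(* The dual row pairs to zero with every block except [k], and [r] involves only the blocks [N],
   [k1] and [l]. *)
have dr : dual G L k l *m (C *m r^T) = 0.
  rewrite raddfB /= mulmxBr mulmxBr !mulmxA (dual_orth GL Lw) // -mulmxA.
  rewrite -[X in _ - X]trmxK [X in _ - X^T](_ : _ = 0); last first.
    rewrite 2!trmx_mul trmxK (gram_sym CE) -mulmxA.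
    apply: (in_span_orth (in_span_combo E M0)) => i ik.
    rewrite -[E _]trmxK -(gram_sym CE) -!trmx_mul (dual_orth GL Lw) //.
    case: eqP => [ki|_]; last by rewrite raddf0 trmx0.
    move: ik; rewrite -ki => -[kE|kE]; first by move: kl; rewrite kE ltnn.
    by move: k1k; rewrite kE ltnn.
  by rewrite (negbTE (neN _ kN)) raddf0 trmx0 subrr.
have [a [b [c dE]]] := dual_combo GL lk lN.
(* The three neighbouring blocks are orthogonal to [r]; there remains the coefficient of [E_N] times
   an invertible matrix. *)
move: dr; rewrite dE mulmxBl [X in X - _ = _](_ : _ = 0); last first.
  have k1l := ltnW (ltn_trans k1k kl).
  apply: (@in_span_orth _ _ _ _ E (past k1 k1 l)) => //.
  apply: in_spanD; last by apply: in_spanE; left; rewrite leqnn k1l.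
  apply: in_spanD; apply: in_spanE; left => /=;
    last by rewrite (ltnW k1k) (ltnW kl).
  rewrite inordK; last by rewrite (leq_ltn_trans (leq_pred _)).
  rewrite (leq_trans (leq_pred _) (ltnW kl)) andbT.
  by rewrite -ltnS prednK // (leq_ltn_trans _ k1k).
rewrite sub0r -[X in - X]mulmxA rr => /eqP; rewrite oppr_eq0 => /eqP.
move=> /(congr1 (mulmx^~ (invmx (r *m C *m r^T)))); rewrite mulmxK // mul0mx.
by move=> /eqP; rewrite subr_eq0 => /eqP.
Qed.

End model.

(** * Rotation invariance of the standard normal law *)

Section normal_plane.
Context {R : realType}.
Local Open Scope ereal_scope.
Local Notation RT := (measurableTypeR R).
Local Notation mu := (@lebesgue_measure R).
Local Notation nu := (@normal_prob R 0%R 1%R).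
Local Notation phi := (@normal_pdf R 0%R 1%R).

Lemma lebesgue_measure_shift (a : R) (A : set R) : measurable A ->
  pushforward mu ((fun x => x + a)%R : RT -> RT) A = mu A.
Proof.
move=> mA; apply/esym/lebesgue_measure_unique => //=.
  by apply: measurable_funD.
move=> ? _ [[b c]] _ <-.
rewrite /pushforward (_ : _ @^-1` _ = `](b - a)%R, (c - a)%R]%classic);
  last first.
  by apply/seteqP; split=> x /=; rewrite !in_itv /= ltrBlDr lerBrDr.
rewrite !lebesgue_measure_itv /= !lte_fin ltrD2r -!EFinB.
by rewrite (_ : c - a - (b - a) = c - b)%R //; ring.
Qed.

Lemma ge0_integral_shift (a : R) (f : R -> \bar R) :
  measurable_fun [set: RT] f -> (forall x, 0 <= f x) ->
  \int[mu]_x f (x + a)%R = \int[mu]_x f x.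
Proof.
move=> mf f0.
have ma : measurable_fun [set: RT] ((fun x => x + a)%R : RT -> RT).
  exact: measurable_funD.
rewrite -(preimage_setT ((fun x => x + a)%R : RT -> RT)).
rewrite -(@ge0_integral_pushforward _ _ _ _ R _ ma mu setT f) //.
by apply: eq_measure_integral => A mA _; exact: lebesgue_measure_shift.
Qed.

(** An iterated integral is chosen because a shear then translates the inner variable by a
    constant. *)
Definition plane_integral (F : RT * RT -> \bar R) : \bar R :=
  \int[mu]_x \int[mu]_y F (x, y).

Lemma plane_integral_shear_snd (t : R) (F : RT * RT -> \bar R) :
  measurable_fun setT F -> (forall z, 0 <= F z) ->
  plane_integral (fun z => F (z.1, z.2 + t * z.1)%R) = plane_integral F.
Proof.
move=> mF F0; apply: eq_integral => x _ /=.
rewrite (ge0_integral_shift _ (f := fun y => F (x, y))) //.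
by apply: measurableT_comp => //; exact: pair1_measurable.
Qed.

Lemma plane_integralC (F : RT * RT -> \bar R) :
  measurable_fun setT F -> (forall z, 0 <= F z) ->
  plane_integral (fun z => F (z.2, z.1)) = plane_integral F.
Proof. by move=> mF F0; rewrite /plane_integral -fubini_tonelli. Qed.

(** This shear is the other one conjugated by the swap of coordinates. *)
Lemma plane_integral_shear_fst (t : R) (F : RT * RT -> \bar R) :
  measurable_fun setT F -> (forall z, 0 <= F z) ->
  plane_integral (fun z => F (z.1 + t * z.2, z.2)%R) = plane_integral F.
Proof.
move=> mF F0; rewrite -[RHS]plane_integralC //.
rewrite -(plane_integral_shear_snd t (F := fun z => F (z.2, z.1))) //;
  last first.
  by apply: measurableT_comp => //; exact: measurable_swap.
rewrite -[RHS]plane_integralC //=.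
apply: measurableT_comp => //; apply/measurable_fun_pair => //=.
by apply: measurable_funD => //; apply: measurable_funM.
Qed.

End normal_plane.

Section normal_rotation.
Context {R : realType}.
Local Open Scope ereal_scope.
Local Notation RT := (measurableTypeR R).
Local Notation mu := (@lebesgue_measure R).
Local Notation nu := (@normal_prob R 0%R 1%R).
Local Notation phi := (@normal_pdf R 0%R 1%R).

(* A rotation other than the half-turn is a product of three shears. *)
Lemma plane_integral_rotation (c s : R) (F : RT * RT -> \bar R) :
  (c ^+ 2 + s ^+ 2 = 1)%R -> (1 + c != 0)%R ->
  measurable_fun setT F -> (forall z, 0 <= F z) ->
  plane_integral (fun z => F (c * z.1 - s * z.2, s * z.1 + c * z.2)%R) =
  plane_integral F.
Proof.
(* For an angle [a] with cosine [c] and sine [s], this [t] is [- tan (a / 2)], which is finite away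
   from the half-turn. *)
move=> cs c1 mF F0; pose t := (- (s / (1 + c)))%R.
pose F1 (z : RT * RT) := F (z.1 + t * z.2, z.2)%R.
pose F2 (z : RT * RT) := F1 (z.1, z.2 + s * z.1)%R.
have mF1 : measurable_fun setT F1.
  apply: measurableT_comp => //; apply/measurable_fun_pair => //=.
  by apply: measurable_funD => //; apply: measurable_funM.
have mF2 : measurable_fun setT F2.
  apply: measurableT_comp => //; apply/measurable_fun_pair => //=.
  by apply: measurable_funD => //; apply: measurable_funM.
have F10 z : 0 <= F1 z by exact: F0.
have F20 z : 0 <= F2 z by exact: F0.
rewrite -(plane_integral_shear_fst t mF F0).
rewrite -(plane_integral_shear_snd s mF1 F10).
rewrite -(plane_integral_shear_fst t mF2 F20); congr plane_integral.
apply/funext => -[x y]; rewrite /F2 /F1 /=.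
have st : (s * t = c - 1)%R.
  have s2 : (s ^+ 2 = 1 - c ^+ 2)%R by rewrite -cs; ring.
  apply: (mulIf c1); transitivity (- s ^+ 2)%R; first by rewrite /t; field.
  by rewrite s2; ring.
have tc : (t * (1 + c) = - s)%R by rewrite /t; field.
have st1 : (1 + s * t = c)%R by rewrite st; ring.
congr (F (_, _)); last by rewrite -st1; ring.
transitivity ((1 + s * t) * x + t * (1 + (1 + s * t)) * y)%R; last by ring.
by rewrite st1 tc; ring.
Qed.

(** The Radon-Nikodym derivative of [nu] equals [phi] almost everywhere, as both have the same
    integral over every measurable set. *)
Lemma ge0_integral_normal_prob (f : RT -> \bar R) :
  measurable_fun setT f -> (forall x, 0 <= f x) ->
  \int[nu]_x f x = \int[mu]_x (f x * (phi x)%:E).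
Proof.
move=> mf f0; have dom : nu `<< mu := normal_prob_dominates 0 1.
pose rn := Radon_Nikodym_SigmaFinite.f nu mu.
have mphi : measurable_fun [set: RT] (EFin \o phi).
  by apply/measurable_EFinP; exact: measurable_normal_pdf.
have irn : mu.-integrable setT rn by exact:
  Radon_Nikodym_SigmaFinite.f_integrable.
have mrn := measurable_int _ irn.
rewrite -(Radon_Nikodym_SigmaFinite.change_of_variables dom f0) //.
apply: ge0_ae_eq_integral => //.
- exact: emeasurable_funM.
- exact: emeasurable_funM.
- by move=> x _; rewrite mule_ge0 // Radon_Nikodym_SigmaFinite.f_ge0.
- by move=> x _; rewrite mule_ge0 // lee_fin normal_pdf_ge0.
have : ae_eq mu setT rn (EFin \o phi).
  apply: integral_ae_eq => // A _ mA.
  by rewrite -Radon_Nikodym_SigmaFinite.f_integral.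
by apply: filterS => x /(_ I) xE _; rewrite -[Radon_Nikodym_SigmaFinite.f _ _
  x]/(rn x) xE.
Qed.

Lemma normal_productE (W : set (RT * RT)) : measurable W ->
  (nu \x nu) W = plane_integral (fun z => (\1_W z * phi z.2 * phi z.1)%:E).
Proof.
move=> mW; rewrite /product_measure1 ge0_integral_normal_prob //; last first.
  exact: measurable_fun_xsection.
apply: eq_integral => x _ /=; rewrite /normal_prob /=.
have mphi : measurable_fun [set: RT] (EFin \o phi).
  by apply/measurable_EFinP; exact: measurable_normal_pdf.
under [RHS]eq_integral do rewrite EFinM.
rewrite ge0_integralZr //.
- congr (_ * _); rewrite [LHS]integral_mkcond; apply: eq_integral => y _.
  rewrite patchE /= EFinM indicE mem_xsection; case: ifP => _.
    by rewrite mul1e.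
  by rewrite mul0e.
- apply/measurable_EFinP/measurable_funM; last exact: measurable_normal_pdf.
  by apply: measurableT_comp; [exact: measurable_indic|exact: pair1_measurable].
- by move=> y _; rewrite lee_fin mulr_ge0 // normal_pdf_ge0.
- by rewrite lee_fin normal_pdf_ge0.
Qed.

(** The joint density depends on the sum of squares only, so the rotation invariance of
    [plane_integral] applies. *)
Lemma normal_product_rotation (c s : R) (W : set (RT * RT)) :
  (c ^+ 2 + s ^+ 2 = 1)%R -> (1 + c != 0)%R -> measurable W ->
  (nu \x nu) [set z | W (c * z.1 - s * z.2, s * z.1 + c * z.2)%R] =
  (nu \x nu) W.
Proof.
move=> cs c1 mW.
have mrot : measurable_fun setT
    (fun z : RT * RT => (c * z.1 - s * z.2, s * z.1 + c * z.2)%R : RT * RT).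
  apply/measurable_fun_pair => /=.
    by apply: measurable_funB; apply: measurable_funM.
  by apply: measurable_funD; apply: measurable_funM.
have mW' : measurable [set z : RT * RT | W (c * z.1 - s * z.2,
  s * z.1 + c * z.2)%R].
  by rewrite -[X in measurable X]setTI; exact: mrot.
rewrite (normal_productE mW') (normal_productE mW).
rewrite -[RHS](plane_integral_rotation cs c1).
- congr plane_integral; apply/funext => -[x y] /=; congr (_%:E).
  rewrite -!mulrA; congr (_ * _)%R.
  have phiM u v : (phi u * phi v =
      normal_peak 1 ^+ 2 * expR (- (u ^+ 2 + v ^+ 2) / (1 ^+ 2 *+ 2)))%R.
    rewrite normal_pdfE ?oner_neq0 // mulrACA -expr2 /normal_fun -expRD -mulrDl.
    by rewrite !subr0 opprD.
  rewrite phiM phiM (_ : (s * x + c * y) ^+ 2 + _ = y ^+ 2 + x ^+ 2)%R //.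
  transitivity ((c ^+ 2 + s ^+ 2) * (y ^+ 2 + x ^+ 2))%R;
    last by rewrite cs mul1r.
  by ring.
- apply/measurable_EFinP/measurable_funM; last first.
    by apply: measurableT_comp; [exact: measurable_normal_pdf|].
  apply: measurable_funM; first exact: measurable_indic.
  by apply: measurableT_comp; [exact: measurable_normal_pdf|].
- by move=> z; rewrite lee_fin !mulr_ge0 // normal_pdf_ge0.
Qed.

End normal_rotation.

(** * Measurability in matrix spaces and uniqueness of measures on boxes *)

Section matrix_measurability.
Context {d} {T : measurableType d} {d'} {U : measurableType d'} {m n : nat}.

Lemma measurable_entry i j :
  measurable_fun [set: 'M[T]_(m, n)] (fun A : 'M[T]_(m, n) => A i j).
Proof.
move=> _ B mB; rewrite setTI; apply: sub_sigma_algebra.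
by exists (i, j) => //; exists B => //; rewrite setTI.
Qed.

Lemma measurable_fun_mx (f : U -> 'M[T]_(m, n)) :
  (forall i j, measurable_fun setT (fun u => f u i j)) -> measurable_fun setT f.
Proof.
move=> mf; apply: (measurability (@entry_sets _ T m n)) => //.
move=> _ [_ [[i j] _ [B mB <-]] <-]; rewrite !setTI.
by rewrite -[X in measurable X]setTI; exact: mf.
Qed.

End matrix_measurability.

Section real_matrix_measurability.
Context {R : realType} {d'} {U : measurableType d'}.

Lemma measurable_fun_mulmx m n p (L : 'M[R]_(m, n)) (f : U -> 'M[R]_(n, p)) :
  measurable_fun setT f -> measurable_fun setT (fun u => L *m f u).
Proof.
move=> mf; apply: measurable_fun_mx => i j; under eq_fun do rewrite mxE.
apply: measurable_sum => k; apply: measurable_funM => //.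
exact: measurableT_comp (measurable_entry k j) mf.
Qed.

Lemma measurable_fun_addmx m n (f g : U -> 'M[R]_(m, n)) :
  measurable_fun setT f -> measurable_fun setT g ->
  measurable_fun setT (fun u => f u + g u).
Proof.
move=> mf mg; apply: measurable_fun_mx => i j; under eq_fun do rewrite mxE.
by apply: measurable_funD; apply: measurableT_comp (measurable_entry i j) _.
Qed.

End real_matrix_measurability.

Section boxes.
Context {d} {T : measurableType d} {R : realType} {m : nat}.

Definition box (B : 'I_m -> set T) : set 'cV[T]_m :=
  [set z | forall i, B i (z i ord0)].

Lemma measurable_box B : (forall i, measurable (B i)) -> measurable (box B).
Proof.
move=> mB; rewrite (_ : box B =
    \bigcap_(i in [set: 'I_m]) [set z : 'cV[T]_m | B i (z i ord0)]).
  apply: fin_bigcap_measurable => // i _; rewrite -[X in measurable X]setTI.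
  exact: measurable_entry.
by apply/seteqP; split=> [z zB i _|z zB i]; [exact: zB|exact: (zB i I)].
Qed.

(** Boxes are stable under intersection, and those constraining a single entry generate the
    sigma-algebra. *)
Lemma box_measure_unique (m1 m2 : {measure set 'cV[T]_m -> \bar R}) :
  (m1 setT < +oo)%E ->
  (forall B, (forall i, measurable (B i)) -> m1 (box B) = m2 (box B)) ->
  forall W, measurable W -> m1 W = m2 W.
Proof.
move=> m1oo m12 W mW.
apply: (measure_unique [set box B | B in [set B | forall i, measurable (B i)]]
  (fun=> setT)) => //.
- apply/seteqP; split.
    apply: smallest_sub; first exact: smallest_sigma_algebra.
    move=> _ [[i j] _ [B mB <-]]; apply: sub_sigma_algebra.
    exists (fun k => if k == i then B else setT) => /=.
      by move=> k; case: ifP.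
    rewrite setTI; apply/seteqP; split=> z /=.
      by move=> /(_ i); rewrite eqxx (ord1 j).
    by rewrite (ord1 j) => zB k; case: eqP => // ->.
  apply: smallest_sub; first exact: sigma_algebra_measurable.
  by move=> _ [B mB <-]; exact: measurable_box.
- move=> _ _ [B mB <-] [C mC <-]; exists (fun i => B i `&` C i).
    by move=> i; exact: measurableI.
  apply/seteqP; split=> z /=; first by move=> zBC; split=> i; case: (zBC i).
  by move=> [zB zC] i; split.
- move=> _; exists (fun=> setT); first by [].
  by apply/seteqP; split.
- by rewrite bigcup_const.
- by move=> _ [B mB <-]; exact: m12.
Qed.

End boxes.

Section image_law.
Context {R : realType} {d1 d2} {T1 : measurableType d1} {T2 :
  measurableType d2}.
Variables (f : T1 -> T2) (mf : measurable_fun setT f).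

Definition to_mfun : {mfun T1 >-> T2} :=
  HB.pack f (isMeasurableFun.Build _ _ _ _ f mf).

Definition image_law (P : probability T1 R) : probability T2 R :=
  distribution P (to_mfun : {RV P >-> T2}).

Definition image_measure (m : {measure set T1 -> \bar R}) :
    {measure set T2 -> \bar R} :=
  measure_function_pushforward__canonical__measure_function_Measure m mf.

Lemma measurable_preimage W : measurable W -> measurable (f @^-1` W).
Proof. by move=> mW; rewrite -[X in measurable X]setTI; exact: mf. Qed.

End image_law.

Section box_independence.
Context {R : realType} {d} {T : measurableType d} (P : probability T R).
Context {m : nat} (X : T -> 'cV[R]_m) (mX : measurable_fun setT X).
Local Open Scope ereal_scope.

(** Both sides are finite measures in [W]: the image of [P] restricted to [C], and the image of [P]
    scaled by [P C]. *)
Lemma box_indep (C : set T) : measurable C ->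
  (forall B, (forall i, measurable (B i)) ->
     P (C `&` X @^-1` box B) = P C * P (X @^-1` box B)) ->
  forall W, measurable W -> P (C `&` X @^-1` W) = P C * P (X @^-1` W).
Proof.
move=> mC PB W mW.
have PCge0 : (0 <= fine (P C))%R by exact: fine_ge0.
have PCE : P C = (fine (P C))%:E by rewrite fineK ?fin_num_measure.
rewrite setIC PCE.
apply: (@box_measure_unique _ R R m (image_measure mX (mrestr P mC))
  (mscale (NngNum PCge0) (image_measure mX P))) => //.
  rewrite /= /pushforward /mrestr preimage_setT setTI.
  by rewrite (le_lt_trans (probability_le1 _ mC)) ?ltry.
move=> B mB; rewrite /= /pushforward /mscale /mrestr /= -PCE setIC.
exact: PB.
Qed.

End box_independence.

(** * Independence of disjoint sets of normal coordinates *)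

Section std_normal.
Context {R : realType}.
Local Notation nu := (@normal_prob R 0%R 1%R).

Lemma std_normal_box m (Q : probability 'cV[R]_m R) (B : 'I_m -> set R) :
  std_normal_law Q -> (forall i, measurable (B i)) ->
  Q (box B) = (\prod_(i < m) nu (B i))%E.
Proof. exact. Qed.

Definition mask m (I : pred 'I_m) : 'M[R]_m :=
  diag_mx (\row_i (I i)%:R).

Lemma maskE m (I : pred 'I_m) n (z : 'M[R]_(m, n)) i j :
  (mask I *m z) i j = if I i then z i j else 0.
Proof.
by rewrite /mask mul_diag_mx !mxE; case: (I i); rewrite ?mul1r ?mul0r.
Qed.

(** Two uses of [box_indep], one for each factor, reduce the claim to boxes, where the product rule
    applies. *)
Lemma std_normal_mask_indep m (Q : probability 'cV[R]_m R) (I : pred 'I_m)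
    (W1 W2 : set 'cV[R]_m) : std_normal_law Q -> measurable W1 ->
      measurable W2 ->
  Q ([set z | W1 (mask I *m z)] `&` [set z | W2 (mask (predC I) *m z)]) =
  (Q [set z | W1 (mask I *m z)] * Q [set z | W2 (mask (predC I) *m z)])%E.
Proof.
move=> Qstd mW1 mW2.
pose X J (z : 'cV[R]_m) := mask J *m z.
have mX J : measurable_fun setT (X J).
  by apply: measurable_fun_mulmx.
rewrite -[[set z | _]]/(X I @^-1` W1) -[[set z | W2 _]]/(X (predC I) @^-1` W2).
have mXW J W : measurable W -> measurable (X J @^-1` W).
  exact: (measurable_preimage (mX J)).
apply: box_indep => // [|B2 mB2]; first exact: mXW.
have mK : measurable (X (predC I) @^-1` box B2).
  by apply: mXW; apply: measurable_box; exact: mB2.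
rewrite setIC [RHS]muleC; apply: box_indep => // B1 mB1.
(* The preimage of a box under a mask is a box: on a coordinate set to 0 the condition holds always
   or never. *)
pose S J (B : 'I_m -> set R) i := [set t : R | B i (if J i then t else 0)].
have mS J B : (forall i, measurable (B i)) -> forall i, measurable (S J B i).
  move=> mB i; rewrite /S; case: (J i); first exact: mB.
  by have [B0|B0] := pselect (B i 0);
    [rewrite (_ : [set _ | _] = setT)|rewrite (_ : [set _ | _] = set0)] => //;
    apply/seteqP; split.
have XE J B : X J @^-1` box B = box (S J B).
  by apply/seteqP; split=> z zB i; have := zB i; rewrite /X /S /= maskE.
have -> : X (predC I) @^-1` box B2 `&` X I @^-1` box B1 =
    box (fun i => S (predC I) B2 i `&` S I B1 i).
  rewrite !XE; apply/seteqP; split=> [z [z2 z1] i|z z12]; first by split.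
  by split=> i; case: (z12 i).
rewrite !XE !std_normal_box //; last first.
- by move=> i; apply: measurableI; [exact: (mS _ B2)|exact: (mS _ B1)].
- exact: (mS _ B2).
- exact: (mS _ B1).
rewrite -big_split /=; apply: eq_bigr => i _; rewrite /S /=; case: (I i) => /=.
  have [B0|B0] := pselect (B2 i 0).
    rewrite (_ : [set _ | B2 i 0] = setT) ?probability_setT ?mul1e ?setTI //.
    by apply/seteqP; split.
  rewrite (_ : [set _ | B2 i 0] = set0) ?measure0 ?mul0e ?set0I ?measure0 //.
  by apply/seteqP; split.
have [B0|B0] := pselect (B1 i 0).
  rewrite (_ : [set _ | B1 i 0] = setT) ?probability_setT ?mule1 ?setIT //.
  by apply/seteqP; split.
rewrite (_ : [set _ | B1 i 0] = set0) ?measure0 ?mule0 ?setI0 ?measure0 //.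
by apply/seteqP; split.
Qed.

End std_normal.

(** * Rotations in coordinate planes *)

Section givens.
Context {R : realType} {m : nat}.
Local Notation nu := (@normal_prob R 0%R 1%R).
Implicit Types (i j : 'I_m) (c s : R).

Definition givens i j c s : 'M[R]_m := \matrix_(a, b)
  if b == i then (a == i)%:R * c + (a == j)%:R * s
  else if b == j then (a == j)%:R * c - (a == i)%:R * s else (a == b)%:R.

Let sum_delta (F : 'I_m -> R) i : \sum_k F k * (k == i)%:R = F i.
Proof.
rewrite (bigD1 i) //= eqxx mulr1 big1 ?addr0 // => k /negbTE ->.
by rewrite mulr0.
Qed.

Lemma mul_givens p (A : 'M[R]_(p, m)) i j c s a b :
  (A *m givens i j c s) a b =
  if b == i then A a i * c + A a j * s
  else if b == j then A a j * c - A a i * s else A a b.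
Proof.
rewrite mxE; under eq_bigr do rewrite mxE.
case: eqP => [_|_]; last case: eqP => [_|_]; last exact: sum_delta.
- under eq_bigr do rewrite mulrDr !mulrA.
  by rewrite big_split -!mulr_suml !sum_delta.
- under eq_bigr do rewrite mulrBr !mulrA.
  by rewrite sumrB -!mulr_suml !sum_delta.
Qed.

Lemma givens_orthogonal i j c s : i != j -> c ^+ 2 + s ^+ 2 = 1 ->
  givens i j c s *m (givens i j c s)^T = 1%:M.
Proof.
(* Identity factors are inserted so that [mul_givens] computes the entries; the two sums differ only
   in their terms [i] and [j]. *)
move=> ij cs; rewrite -[X in X *m _]mul1mx -[X in _ *m X^T]mul1mx.
rewrite -[RHS]mul1mx -[X in _ = _ *m X]trmx1; apply/matrixP => a b.
rewrite ![(_ *m _^T) a b]mxE (bigD1 i) //= (bigD1 j) 1?eq_sym //=.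
rewrite [RHS](bigD1 i) //= [X in _ = _ + X](bigD1 j) 1?eq_sym //= !addrA.
congr (_ + _); last first.
  apply: eq_bigr => k /andP[ki kj].
  by rewrite ![(_^T) k b]mxE !mul_givens (negbTE ki) (negbTE kj).
rewrite ![(_^T) _ b]mxE !mul_givens !eqxx eq_sym (negbTE ij).
set x := 1%:M a i; set y := 1%:M a j; set u := 1%:M b i; set v := 1%:M b j.
transitivity ((c ^+ 2 + s ^+ 2) * (x * u + y * v)); first by ring.
by rewrite cs mul1r.
Qed.

(** The rotated box splits into a condition [W1] on the coordinates [i] and [j] and a box [W2] in
    the others. The two are independent, and the probability of [W1] comes from the planar
    rotation. *)
Lemma std_normal_givens (Q : probability 'cV[R]_m R) i j c s
    (mG : measurable_fun setT (mulmx (givens i j c s)^T : 'cV[R]_m ->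
      'cV[R]_m)) :
  i != j -> c ^+ 2 + s ^+ 2 = 1 -> 1 + c != 0 -> std_normal_law Q ->
  std_normal_law (image_law mG Q).
Proof.
move=> ij cs c1 Qstd B mB.
have ji : (j == i) = false by rewrite eq_sym; exact/negbTE.
pose I : pred 'I_m := fun k => (k == i) || (k == j).
have GE (z : 'cV[R]_m) k : ((givens i j c s)^T *m z) k ord0 =
    if k == i then z i ord0 * c + z j ord0 * s
    else if k == j then z j ord0 * c - z i ord0 * s else z k ord0.
  by rewrite -[z]trmxK -trmx_mul mxE mul_givens !mxE.
pose W1 := [set z : 'cV[R]_m |
  B i (z i ord0 * c + z j ord0 * s) /\ B j (z j ord0 * c - z i ord0 * s)].
pose W2 : set 'cV[R]_m := box (fun k => if I k then setT else B k).
have -> : image_law mG Q [set z | forall k, B k (z k ord0)] =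
    Q ([set z | W1 (mask I *m z)] `&` [set z | W2 (mask (predC I) *m z)]).
  congr (Q _); apply/seteqP; split=> z /=.
    move=> zB; split=> /=.
      rewrite /W1 /= !maskE /I !eqxx orbT /=; split.
        by have := zB i; rewrite GE eqxx.
      by have := zB j; rewrite GE ji eqxx.
    move=> k; rewrite maskE /= /I; case: ifP => //=.
    move=> /negbT; rewrite negb_or => /andP[ki kj].
    by have := zB k; rewrite GE (negbTE ki) (negbTE kj).
  move=> [z1 z2] k; rewrite GE; have := z1;
    rewrite /W1 /= !maskE /I !eqxx orbT /=.
  move=> [zi zj]; case: eqP => [->//|/eqP ki]; case: eqP => [->//|/eqP kj].
  by have := z2 k; rewrite maskE /= /I (negbTE ki) (negbTE kj).
have mW2 : measurable W2.
  by apply: measurable_box => k; case: (I k).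
have me k : measurable_fun setT (fun z : 'cV[R]_m => z k ord0).
  exact: measurable_entry.
have mpair : measurable_fun setT
    (fun z : 'cV[R]_m => (z i ord0, z j ord0) :
      measurableTypeR R * measurableTypeR R).
  by apply: measurable_fun_pair; exact: me.
have mW1 : measurable W1.
  rewrite (_ : W1 = [set z | B i (z i ord0 * c + z j ord0 * s)] `&`
                    [set z | B j (z j ord0 * c - z i ord0 * s)]) //.
  apply: measurableI; rewrite -[X in measurable X]setTI.
    by apply: (measurable_funD (measurable_funM (me _) (measurable_cst c))
      (measurable_funM (me _) (measurable_cst s))).
  by apply: (measurable_funB (measurable_funM (me _) (measurable_cst c))
    (measurable_funM (me _) (measurable_cst s))).
rewrite std_normal_mask_indep //.
(* The coordinates [i] and [j] have joint law [nu \x nu], by uniqueness on rectangles. *)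
have Qpair W : measurable W ->
    (nu \x nu)%E W = Q [set z | W (z i ord0, z j ord0)].
  move=> mW; apply: (product_measure_unique (m' := image_law mpair Q)) => //.
  move=> A1 A2 mA1 mA2.
  transitivity (Q (box (fun k => if k == i then A1 else if k == j then A2 else
    setT))).
    congr (Q _); apply/seteqP; split=> z /=.
      by move=> [z1 z2] k; case: eqP => [->//|_]; case: eqP => [->|].
    move=> zA; split; first by have := zA i; rewrite eqxx.
    by have := zA j; rewrite ji eqxx.
  rewrite std_normal_box //; last by move=> k; case: ifP => // _; case: ifP.
  rewrite (bigD1 i) //= eqxx (bigD1 j) ?ji //= eqxx.
  rewrite big1 ?mule1 // => k /andP[/negbTE -> /negbTE ->].
  exact: probability_setT.
have -> : Q [set z | W1 (mask I *m z)] = (nu (B i) * nu (B j))%E.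
  have mBB : measurable (B i `*` B j) by exact: measurableX.
  (* The transpose turns by the opposite angle, hence the sign of [s]. *)
  have cNs : c ^+ 2 + (- s) ^+ 2 = 1 by rewrite sqrrN.
  transitivity ((nu \x nu)%E (B i `*` B j)); last by rewrite product_measure1E;
    [|exact: mB|exact: mB].
  rewrite -(normal_product_rotation cNs c1 mBB).
  have mrot : measurable [set z : measurableTypeR R * measurableTypeR R |
      (B i `*` B j) (c * z.1 - - s * z.2, - s * z.1 + c * z.2)].
    rewrite -[X in measurable X]setTI; apply:
      (measurable_fun_pair _ _ measurableT mBB).
      by apply: measurable_funB; apply: measurable_funM.
    by apply: measurable_funD; apply: measurable_funM.
  rewrite Qpair //; congr (Q _); apply/seteqP; split=> z /=;
    rewrite /W1 /= !maskE /I !eqxx orbT /= ![c * _]mulrC mulNr opprK (mulrC s);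
    by rewrite mulNr addrC [- (s * _) + _]addrC (mulrC s).
have -> : Q [set z | W2 (mask (predC I) *m z)] =
  (\prod_(k < m | ~~ I k) nu (B k))%E.
  rewrite (_ : [set z | _] = W2); last first.
    apply/seteqP; split=> z zW k; have := zW k; rewrite /= maskE /=;
    by case: (I k).
  rewrite std_normal_box // => [|k]; last by case: (I k).
  rewrite [RHS]big_mkcond /=; apply: eq_bigr => k _; case: (I k) => //=.
  exact: probability_setT.
rewrite [RHS](bigD1 i) //= [X in (_ = _ * X)%E](bigD1 j) ?ji //= muleA.
by congr (_ * _)%E; apply: eq_bigl => k; rewrite /I negb_or.
Qed.

End givens.

Section normal_rotation.
Context {R : realType}.

(** The existential over [Q'] lets such matrices be multiplied without identifying the two laws. *)
Definition normal_rotation m (U : 'M[R]_m) : Prop :=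
  U *m U^T = 1%:M /\
  forall Q : probability 'cV[R]_m R, std_normal_law Q ->
    exists2 Q' : probability 'cV[R]_m R, std_normal_law Q' &
      forall W, measurable W -> Q W = Q' [set z | W (U *m z)].

Lemma measurable_mulmx m n p (L : 'M[R]_(m, n)) :
  measurable_fun setT (mulmx L : 'M[R]_(n, p) -> 'M[R]_(m, p)).
Proof. exact: measurable_fun_mulmx. Qed.

Lemma normal_rotation1 m : normal_rotation (1%:M : 'M[R]_m).
Proof.
split=> [|Q Qstd]; first by rewrite trmx1 mulmx1.
by exists Q => // W _; congr (Q _); apply/seteqP; split=> z /=; rewrite mul1mx.
Qed.

Lemma normal_rotationM m (U U' : 'M[R]_m) :
  normal_rotation U -> normal_rotation U' -> normal_rotation (U *m U').
Proof.
move=> [OO ON] [OO' ON']; split.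
  by rewrite trmx_mul mulmxA -(mulmxA U) OO' mulmx1.
move=> Q /ON[Q1 /ON'[Q2 Q2std Q12] Q01]; exists Q2 => // W mW.
rewrite Q01 // Q12; last exact: (measurable_preimage (measurable_mulmx U)).
by congr (Q2 _); apply/seteqP; split=> z /=; rewrite mulmxA.
Qed.

Lemma normal_rotation_givens m (i j : 'I_m) c s :
  i != j -> c ^+ 2 + s ^+ 2 = 1 -> 1 + c != 0 ->
  normal_rotation (givens i j c s).
Proof.
move=> ij cs c1; have GG := givens_orthogonal ij cs; split=> // Q Qstd.
have mG := @measurable_mulmx m m 1 (givens i j c s)^T.
exists (image_law mG Q); first exact: std_normal_givens.
move=> W mW; congr (Q _); apply/seteqP; split=> z /=;
  by rewrite mulmxA GG mul1mx.
Qed.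

(** Normalise [(v_i, v_j)] to get [c] and [s]. The excluded half-turn would need [c = -1], hence
    [v_j = 0], and in that case the identity rotation is used. *)
Lemma givens_kill m (v : 'rV[R]_m) (i j : 'I_m) : i != j ->
  exists c s, normal_rotation (givens i j c s) /\ (v *m givens i j c s) ord0 j =
    0.
Proof.
move=> ij; have [vj0|vj0] := eqVneq (v ord0 j) 0.
  exists 1, 0; split.
    by apply: normal_rotation_givens; rewrite ?expr1n ?expr0n ?addr0 //
      pnatr_eq0.
  by rewrite mul_givens eq_sym (negbTE ij) eqxx vj0 mul0r mulr0 subr0.
pose h := v ord0 i ^+ 2 + v ord0 j ^+ 2.
have h_gt0 : 0 < h by rewrite ltr_wpDl ?sqr_ge0 // exprn_even_gt0.
pose r := Num.sqrt h; have r_gt0 : 0 < r by rewrite sqrtr_gt0.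
have rr : r ^+ 2 = h by rewrite sqr_sqrtr // ltW.
exists (v ord0 i / r), (v ord0 j / r); split; last first.
  by rewrite mul_givens eq_sym (negbTE ij) eqxx; field; rewrite gt_eqF.
apply: normal_rotation_givens => //.
  by rewrite !expr_div_n rr -mulrDl divff // gt_eqF.
apply/eqP => c1; case/eqP: vj0; apply/eqP; rewrite -sqrf_eq0.
have -> : v ord0 j ^+ 2 = r ^+ 2 - v ord0 i ^+ 2 by rewrite rr /h; ring.
have -> : v ord0 i = - r.
  have : v ord0 i / r = -1 by move: c1 => /eqP; rewrite addrC addr_eq0 => /eqP.
  by move=> /(congr1 ( *%R^~ r)); rewrite mulfVK ?gt_eqF // mulN1r.
by rewrite sqrrN subrr.
Qed.

(** Rotating each [j] of the list against the pivot [i] moves the weight of [v] into [i]. The last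
    two clauses preserve what was achieved for rows treated earlier. *)
Lemma normal_rotation_clear m (J : pred 'I_m) (i : 'I_m) (v : 'rV[R]_m)
    (js : seq 'I_m) : J i -> (forall j, j \in js -> J j && (i != j)) ->
  exists U, [/\ normal_rotation U, forall j, j \in js -> (v *m U) ord0 j = 0,
    forall p (A : 'M[R]_(p, m)) a k, ~~ J k -> (A *m U) a k = A a k &
    forall p (A : 'M[R]_(p, m)) a, (forall k, J k -> A a k = 0) ->
      forall k, J k -> (A *m U) a k = 0].
Proof.
move=> Ji; elim: js => [|j js IH] jsJ.
  exists 1%:M; split=> // [|p A a k _|p A a A0 k Jk];
    first exact: normal_rotation1.
    by rewrite mulmx1.
  by rewrite mulmx1 A0.
have [k kjs|U [rO vO Ofix O0]] := IH; first by apply: jsJ; rewrite inE kjs orbT.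
have /andP[Jj ij] := jsJ j (mem_head _ _).
have [c [s [rG vG]]] := givens_kill (v *m U) ij.
exists (U *m givens i j c s); split.
- exact: normal_rotationM.
- move=> k; rewrite inE mulmxA => /predU1P[-> //|kjs].
  have [->//|kj] := eqVneq k j.
  have /andP[_ ik] : J k && (i != k) by apply: jsJ; rewrite inE kjs orbT.
  by rewrite mul_givens eq_sym (negbTE ik) (negbTE kj) vO.
- move=> p A a k Jk; rewrite mulmxA mul_givens.
  case: eqP => [ki|_]; first by rewrite ki Ji in Jk.
  by case: eqP => [kj|_]; [rewrite kj Jj in Jk|exact: Ofix].
- move=> p A a A0 k Jk; rewrite mulmxA mul_givens !(O0 _ _ _ A0) //.
  by rewrite !mul0r addr0 subr0; case: ifP => // _; case: ifP.
Qed.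

(** The rows of [A] are treated one by one; [I] collects the coordinates carrying the rows treated
    so far, and [B] vanishes there. *)
Lemma normal_rotation_split m p q (A : 'M[R]_(p, m)) (B : 'M[R]_(q, m)) :
  A *m B^T = 0 ->
  exists U (I : pred 'I_m), [/\ normal_rotation U,
    forall a k, ~~ I k -> (A *m U) a k = 0 &
    forall b k, I k -> (B *m U) b k = 0].
Proof.
move=> AB; suff split_rows r : (r <= p)%N ->
    exists U (I : pred 'I_m), [/\ normal_rotation U,
      forall (a : 'I_p) k, (a < r)%N -> ~~ I k -> (A *m U) a k = 0 &
      forall b k, I k -> (B *m U) b k = 0].
  have [U [I [rU AU BU]]] := split_rows p (leqnn p).
  by exists U, I; split=> // a k; apply: AU.
elim: r => [_|r IH rp].
  by exists 1%:M, pred0; split=> //; exact: normal_rotation1.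
have [U [I [rO AO BO]]] := IH (ltnW rp).
(* Choose a pivot outside [I]; if there is none, the condition on [A] is vacuous. *)
have [[i Ii]|allI] := pselect (exists i, ~~ I i); last first.
  exists U, I; split=> // a k _ Ik; by case: allI; exists k.
pose a0 := Ordinal rp; pose v := row a0 (A *m U).
have [|j|U1 [rO1 vO1 Ofix O0]] := @normal_rotation_clear m (predC I) i v
  [seq j <- enum 'I_m | predC I j && (i != j)]; first by [].
  by rewrite mem_filter => /andP[].
have AO1 (a : 'I_p) k : (a < r)%N -> ~~ I k -> (A *m (U *m U1)) a k = 0.
  by move=> ar Ik; rewrite mulmxA O0 // => l; exact: AO.
have BO1 b k : I k -> (B *m (U *m U1)) b k = 0.
  by move=> Ik; rewrite mulmxA Ofix /= ?Ik ?BO.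
have AO10 k : ~~ I k -> k != i -> (A *m (U *m U1)) a0 k = 0.
  move=> Ik ki; have := vO1 k; rewrite mem_filter mem_enum /= Ik eq_sym ki =>
    /(_ isT).
  by rewrite -row_mul mxE mulmxA.
have aE (a : 'I_p) : (a < r.+1)%N -> (a < r)%N \/ a = a0.
  by rewrite ltnS leq_eqVlt => /predU1P[ar|]; [right; apply/val_inj|left].
have rOO1 := normal_rotationM rO rO1.
(* The new row now lives on [I] and [i]. If its entry at [i] vanishes, [I] is kept; otherwise [i]
   joins [I]. *)
have [A0i|A0i] := eqVneq ((A *m (U *m U1)) a0 i) 0.
  exists (U *m U1), I; split=> // a k /aE[ar Ik|-> Ik]; first exact: AO1.
  by have [->//|ki] := eqVneq k i; exact: AO10.
exists (U *m U1), (predU I (pred1 i)); split=> //.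
  move=> a k /aE[ar|->] /=; rewrite negb_or => /andP[Ik ki]; first exact: AO1.
  exact: AO10.
move=> b k /orP[|/eqP ->]; first exact: BO1.
(* Only the term of index [i] survives in this scalar product, so orthogonality kills the entry of
   [B] there. *)
have : ((A *m (U *m U1)) *m (B *m (U *m U1))^T) a0 b = 0.
  by rewrite trmx_mul -mulmxA (mulmxA (U *m U1)) rOO1.1 mul1mx AB mxE.
rewrite mxE (bigD1 i) //= big1 ?addr0 => [|l li].
  by rewrite [_^T _ _]mxE => /eqP; rewrite mulf_eq0 (negbTE A0i) => /eqP.
rewrite [_^T _ _]mxE; have [Il|Il] := boolP (I l).
  by rewrite (BO1 _ _ Il) mulr0.
by rewrite (AO10 _ Il li) mul0r.
Qed.

End normal_rotation.

(** * Second moments and uncorrelated Gaussian vectors *)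

Section second_order.
Context {R : realType} {d} {T : measurableType d} (P : probability T R).

Definition square_integrable n (X : T -> 'cV[R]_n) : Prop :=
  measurable_fun setT X /\
  forall i, P.-integrable setT (fun w => (X w i ord0 ^+ 2)%:E).

Lemma Rintegral_sum (I : Type) (r : seq I) (f : I -> T -> R) :
  (forall i, P.-integrable setT (EFin \o f i)) ->
  \int[P]_w (\sum_(i <- r) f i w) = \sum_(i <- r) \int[P]_w (f i w).
Proof.
move=> fi; elim: r => [|i r IH].
  under eq_Rintegral do rewrite big_nil.
  by rewrite big_nil Rintegral_cst // mul0r.
under eq_Rintegral do rewrite big_cons.
rewrite big_cons RintegralD ?IH //.
apply: (eq_integrable _ (fun w => \sum_(j <- r) (f j w)%:E)%E) => //.
  by move=> w _; rewrite /= sumEFin.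
by apply: integrable_sum => // j _; exact: fi.
Qed.

Section vector.
Context n (X : T -> 'cV[R]_n) (X2 : square_integrable X).

Lemma measurable_coord i : measurable_fun setT (fun w => X w i ord0).
Proof. exact: measurableT_comp (measurable_entry i ord0) X2.1. Qed.

Lemma integrable_coordM i j :
  P.-integrable setT (EFin \o (fun w => X w i ord0 * X w j ord0)).
Proof.
apply: (le_integrable _ _ _ (integrableD measurableT (X2.2 i) (X2.2 j))) => //.
  by apply/measurable_EFinP; apply: measurable_funM; exact: measurable_coord.
move=> w _ /=; rewrite lee_fin (ger0_norm (addr_ge0 _ _)) ?sqr_ge0 //.
rewrite normrM -(real_normK (num_real (X w i ord0))) -(real_normK (num_real (X w
  j ord0))).
have := sqr_ge0 (`|X w i ord0| - `|X w j ord0|).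
have := normr_ge0 (X w i ord0); have := normr_ge0 (X w j ord0).
move: `|_| `|_| => x y x0 y0; rewrite sqrrB.
have : 0 <= x * y by exact: mulr_ge0.
by rewrite mulr2n; lra.
Qed.

Lemma integrable_coord i : P.-integrable setT (EFin \o (fun w => X w i ord0)).
Proof.
have i1 : P.-integrable setT (cst 1%E : T -> \bar R).
  exact: finite_measure_integrable_cst.
apply: (le_integrable _ _ _ (integrableD measurableT i1 (X2.2 i))) => //.
  by apply/measurable_EFinP; exact: measurable_coord.
move=> w _ /=; rewrite lee_fin (ger0_norm (addr_ge0 _ _)) ?sqr_ge0 //.
rewrite -(real_normK (num_real (X w i ord0))).
have := sqr_ge0 (`|X w i ord0| - 1); have := normr_ge0 (X w i ord0).
by move: `|_| => x x0; rewrite sqrrB mulr1 expr1n mulr2n; lra.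
Qed.

Lemma zero_mean_mulmx m (L : 'M[R]_(m, n)) :
  zero_mean P X -> zero_mean P (fun w => L *m X w).
Proof.
move=> X0 a; rewrite unlock.
under eq_integral do rewrite mxE -sumEFin.
rewrite integral_sum // => [|k].
  rewrite big1 // => k _; under eq_integral do rewrite EFinM.
  rewrite integralZl //; last exact: integrable_coord.
  by have := X0 k; rewrite unlock => ->; rewrite mule0.
under eq_fun do rewrite EFinM.
by apply: integrableZl => //; exact: integrable_coord.
Qed.

Lemma cov_mx_zero_mean p q (Y : T -> 'cV[R]_p) (Z : T -> 'cV[R]_q) :
  zero_mean P Y -> zero_mean P Z ->
  cov_mx P Y Z =
  \matrix_(i, j) \int[P]_w (Y w i ord0 * Z w j ord0).
Proof.
move=> Y0 Z0; apply/matrixP => i j; rewrite !mxE unlock Y0 Z0 /= unlock.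
by congr fine; apply: eq_integral => w _; rewrite /= !fctE /= !subr0.
Qed.

Lemma cov_mx_mulmx p q (L : 'M[R]_(p, n)) (K : 'M[R]_(q, n)) :
  zero_mean P X ->
  cov_mx P (fun w => L *m X w) (fun w => K *m X w) = L *m cov_mx P X X *m K^T.
Proof.
move=> X0; rewrite !cov_mx_zero_mean //; try exact: zero_mean_mulmx.
apply/matrixP => a b; rewrite !mxE.
transitivity (\int[P]_w (\sum_i \sum_j (L a i * K b j) * (X w i ord0 * X w j
  ord0))).
  apply: eq_Rintegral => w _; rewrite !mxE big_distrlr /=.
  by apply: eq_bigr => i _; apply: eq_bigr => j _; rewrite mulrACA.
have iLK i j : P.-integrable setT
    (EFin \o (fun w => L a i * K b j * (X w i ord0 * X w j ord0))).
  apply: (eq_integrable _ (fun w => (L a i * K b j)%:E * (X w i ord0 * X w j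
    ord0)%:E)%E) => //.
  by apply: integrableZl => //; exact: integrable_coordM.
rewrite Rintegral_sum => [|i]; last first.
  apply: (eq_integrable _ (fun w => \sum_j (L a i * K b j * (X w i ord0 * X w j
    ord0))%:E)%E) => //.
    by move=> w _; rewrite /= sumEFin.
  by apply: integrable_sum => // j _; exact: iLK.
transitivity (\sum_i \sum_j L a i * K b j * \int[P]_w (X w i ord0 * X w j
  ord0)).
  apply: eq_bigr => i _; rewrite Rintegral_sum //.
  by apply: eq_bigr => j _; rewrite RintegralZl //; exact: integrable_coordM.
rewrite exchange_big /=; apply: eq_bigr => j _; rewrite !mxE mulr_suml.
by apply: eq_bigr => i _; rewrite !mxE mulrAC.
Qed.

End vector.

(** The recursion of the theorem and the equality of conditional means are known almost surely only;
    covariances do not see the difference. *)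
Lemma cov_mx_ae p q (Y Y' : T -> 'cV[R]_p) (Z Z' : T -> 'cV[R]_q) :
  measurable_fun setT Y -> measurable_fun setT Y' ->
  measurable_fun setT Z -> measurable_fun setT Z' ->
  {ae P, forall w, Y w = Y' w} -> {ae P, forall w, Z w = Z' w} ->
  cov_mx P Y Z = cov_mx P Y' Z'.
Proof.
move=> mY mY' mZ mZ' YY' ZZ'; apply/matrixP => i j; rewrite !mxE; congr fine.
have Eae r (V V' : T -> 'cV[R]_r) k : measurable_fun setT V ->
    measurable_fun setT V' -> {ae P, forall w, V w = V' w} ->
    ('E_P[(fun w => V w k ord0)] = 'E_P[(fun w => V' w k ord0)])%E.
  move=> mV mV' VV'; rewrite unlock; apply: ae_eq_integral => //.
  - by apply/measurable_EFinP; exact: measurableT_comp (measurable_entry k ord0)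
      mV.
  - by apply/measurable_EFinP; exact: measurableT_comp (measurable_entry k ord0)
      mV'.
  - by apply: filterS VV' => w -> _.
have me r (V : T -> 'cV[R]_r) k c : measurable_fun setT V ->
    measurable_fun setT (fun w => V w k ord0 - c).
  move=> mV; apply: measurable_funB => //.
  exact: measurableT_comp (measurable_entry k ord0) mV.
rewrite unlock (Eae _ _ _ _ mY mY' YY') (Eae _ _ _ _ mZ mZ' ZZ') unlock.
apply: ae_eq_integral => //.
- by apply/measurable_EFinP; apply: measurable_funM; exact: me.
- by apply/measurable_EFinP; apply: measurable_funM; exact: me.
- by apply: filterS2 YY' ZZ' => w Yw Zw _; rewrite /= !fctE /= Yw Zw.
Qed.

End second_order.

(** * Moments of the standard normal law *)

Section normal_moments.
Context {R : realType}.
Local Notation nu := (@normal_prob R 0%R 1%R).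
Local Notation RT := (measurableTypeR R).

(** The symmetry comes from the quarter-turn [c = 0], [s = 1], which pulls a strip over [A] in one
    coordinate back to a strip over [-A] in the other. *)
Lemma normal_probN (A : set R) : measurable A ->
  nu ((-%R : RT -> RT) @^-1` A) = nu A.
Proof.
move=> mA.
have mNA : measurable ((-%R : RT -> RT) @^-1` A).
  by rewrite -[X in measurable X]setTI; exact: oppr_measurable.
have mAT : measurable (A `*` setT : set (RT * RT)) by exact: measurableX.
have cs : 0 ^+ 2 + 1 ^+ 2 = 1 :> R by rewrite expr0n expr1n add0r.
have c1 : 1 + 0 != 0 :> R by rewrite addr0 oner_neq0.
have := normal_product_rotation cs c1 mAT.
rewrite (_ : [set z | _] = setT `*` ((-%R : RT -> RT) @^-1` A)); last first.
  by apply/seteqP; split=> -[s t] /=; rewrite mul0r mul1r sub0r; case.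
rewrite !product_measure1E // => nuA.
have nuT : nu setT = 1%E := probability_setT (normal_prob 0 1).
by have : (nu setT * nu (-%R @^-1` A) = nu A * nu setT)%E := nuA;
  rewrite nuT mule1 mul1e.
Qed.

Lemma integrable_normal_sqr : nu.-integrable setT (fun t : RT => (t ^+ 2)%:E).
Proof.
have msqr : measurable_fun [set: RT] (fun t : RT => (t ^+ 2)%:E).
  by apply/measurable_EFinP; apply: measurable_funX.
apply/integrableP; split=> //.
under eq_integral do rewrite /= ger0_norm ?sqr_ge0 //.
rewrite ge0_integral_normal_prob // => [|t]; last by rewrite lee_fin sqr_ge0.
have p2 : 0 < normal_peak (2 : R) by apply: normal_peak_gt0; rewrite pnatr_eq0.
have p1 : 0 < normal_peak (1 : R) by apply: normal_peak_gt0; rewrite oner_neq0.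
(* Compare with the density of standard deviation 2: the exponents differ by [3 / 8 * t ^+ 2], and
   [t ^+ 2 <= 8 / 3 * expR (3 / 8 * t ^+ 2)]. *)
pose k : R := 8 / 3 * normal_peak 1 / normal_peak 2.
have k0 : 0 <= k by rewrite /k !mulr_ge0 ?invr_ge0 // ltW.
apply: (@le_lt_trans _ _ (\int[lebesgue_measure]_(t in [set:
  RT]) (k%:E * (normal_pdf 0 2 t)%:E))%E).
  apply: ge0_le_integral => //.
  - by move=> t _; rewrite mule_ge0 // lee_fin ?sqr_ge0 ?normal_pdf_ge0.
  - by apply: emeasurable_funM => //; apply/measurable_EFinP;
      exact: measurable_normal_pdf.
  - by apply: emeasurable_funM => //; apply/measurable_EFinP;
      exact: measurable_normal_pdf.
  move=> t _; rewrite -!EFinM lee_fin !normal_pdfE ?oner_neq0 ?pnatr_eq0 //.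
  rewrite /k /normal_fun !subr0.
  have -> : - t ^+ 2 / (1 ^+ 2 *+ 2) = - t ^+ 2 / (2 ^+ 2 *+ 2) - 3 / 8 * t ^+ 2
    by field.
  rewrite expRD; set E := expR (- t ^+ 2 / _).
  rewrite (_ : 8 / 3 * _ / _ * _ = normal_peak 1 * E * (8 / 3)); last first.
    by field; rewrite gt_eqF.
  rewrite (_ : t ^+ 2 * _ = normal_peak 1 * E * (t ^+ 2 * expR (- (3 / 8 * t ^+
    2)))); last by ring.
  rewrite ler_wpM2l //; first by rewrite mulr_ge0 ?expR_ge0 // ltW.
  rewrite expRN ler_pdivrMr ?expR_gt0 //.
  have := expR_ge1Dx (3 / 8 * t ^+ 2).
  by lra.
rewrite ge0_integralZl //.
- by rewrite integral_normal_pdf mule1 ltry.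
- by apply/measurable_EFinP; exact: measurable_normal_pdf.
- by move=> t _; rewrite lee_fin normal_pdf_ge0.
Qed.

End normal_moments.

Section std_normal_moments.
Context {R : realType} {m : nat} (Q : probability 'cV[R]_m R).
Hypothesis Qstd : std_normal_law Q.
Local Notation nu := (@normal_prob R 0%R 1%R).

Lemma std_normal_coord i (f : R -> \bar R) :
  measurable_fun setT f -> (forall t, 0 <= f t)%E ->
  (\int[Q]_z f (z i ord0) = \int[nu]_t f t)%E.
Proof.
move=> mf f0.
have me : measurable_fun setT (fun z : 'cV[R]_m => z i ord0 :
  measurableTypeR R).
  exact: measurable_entry.
rewrite -(preimage_setT (fun z : 'cV[R]_m => z i ord0 : measurableTypeR R)).
rewrite -(@ge0_integral_pushforward _ _ _ _ R _ me Q setT f) //.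
apply: eq_measure_integral => A mA _.
transitivity (Q (box (fun k => if k == i then A else setT))).
  congr (Q _); apply/seteqP; split=> z /=; first by move=> zA k;
    case: eqP => // ->.
  by move=> /(_ i); rewrite eqxx.
rewrite std_normal_box // => [|k]; last by case: ifP.
rewrite (bigD1 i) //= eqxx big1 ?mule1 // => k /negbTE ->.
exact: probability_setT.
Qed.

Definition flip i : 'M[R]_m := diag_mx (\row_k (-1) ^+ (k == i)).

Lemma flipE i (z : 'cV[R]_m) k :
  (flip i *m z) k ord0 = if k == i then - z k ord0 else z k ord0.
Proof. by rewrite mul_diag_mx !mxE; case: eqP; rewrite ?mulN1r ?mul1r. Qed.

(** On boxes a flip mirrors one side, which keeps its normal probability. Moments odd in some
    coordinate vanish as a consequence. *)
Lemma std_normal_flip i (g : 'cV[R]_m -> R) : measurable_fun setT g ->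
  Q.-integrable setT (EFin \o g) ->
  \int[Q]_z g (flip i *m z) = \int[Q]_z g z.
Proof.
move=> mg ig; have mF := @measurable_mulmx R m m 1 (flip i).
have QF W : measurable W -> image_law mF Q W = Q W.
  apply: box_measure_unique => [|B mB].
    by rewrite (le_lt_trans (probability_le1 _ _)) ?ltry.
  pose B' k := if k == i then (-%R : R -> R) @^-1` B k else B k.
  have mB' k : measurable (B' k).
    rewrite /B'; case: ifP => // _; rewrite -[X in measurable X]setTI.
    exact: oppr_measurable.
  transitivity (Q (box B')).
    congr (Q _); apply/seteqP; split=> z zB k; have := zB k;
    by rewrite flipE /B'; case: eqP.
  apply: (etrans (std_normal_box Qstd mB')).
  apply: (etrans _ (esym (std_normal_box Qstd mB))).
  apply: eq_bigr => k _; rewrite /B'.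
  by case: eqP => // _; exact: normal_probN.
have QE : (\int[Q]_z (g z)%:E = \int[image_law mF Q]_z (g z)%:E)%E.
  by apply: eq_measure_integral => W mW _; exact: esym (QF _ mW).
congr fine; rewrite QE [RHS]integral_pushforward //=.
- exact/measurable_EFinP.
- rewrite preimage_setT; apply/integrableP; split.
    apply/measurable_EFinP; apply: measurableT_comp => //.
  move/integrableP : ig => [_]; apply: le_lt_trans.
  rewrite (_ : (\int[Q]_z `|(g z)%:E| = \int[image_law mF Q]_z `|(g z)%:E|)%E);
    last first.
    by apply: eq_measure_integral => W mW _; exact: esym (QF _ mW).
  rewrite [leRHS]ge0_integral_pushforward //.
  by apply: measurableT_comp => //; exact/measurable_EFinP.
Qed.

Lemma std_normal_square_integrable : square_integrable Q idfun.
Proof.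
split=> [|i]; first exact: measurable_id.
apply/integrableP; split.
  by apply/measurable_EFinP; apply: measurable_funX; exact: measurable_entry.
under eq_integral do rewrite /= ger0_norm ?sqr_ge0 //.
have /integrableP[m2 i2] := @integrable_normal_sqr R.
rewrite (std_normal_coord i (f := fun t => (t ^+ 2)%:E)) //.
  by under eq_integral do rewrite -[(_ ^+ 2)%R]ger0_norm ?sqr_ge0 //.
by move=> t; rewrite lee_fin sqr_ge0.
Qed.

Lemma std_normal_zero_mean : zero_mean Q idfun.
Proof.
move=> i; have Q2 := std_normal_square_integrable.
have ii := integrable_coord Q2 i.
have := std_normal_flip i (measurable_coord Q2 i) ii.
under eq_Rintegral do rewrite flipE eqxx.
rewrite /Rintegral; under eq_integral do rewrite EFinN.
rewrite integralN //; last first.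
  exact/integrable_add_def.
have : (\int[Q]_z (z i ord0)%:E)%E \is a fin_num by exact: integrable_fin_num.
rewrite unlock; case: (\int[Q]_z _)%E => // r _ /= rE.
by congr (_%:E); lra.
Qed.

(** Mixed moments vanish by a flip, and all squares have the same integral, kept as an unevaluated
    [v]. *)
Lemma std_normal_cov : exists2 v : R, 0 <= v & cov_mx Q idfun idfun = v%:M.
Proof.
have Q2 := std_normal_square_integrable; have Q0 := std_normal_zero_mean.
exists (fine (\int[nu]_t (t ^+ 2)%:E)).
  by apply: fine_ge0; apply: integral_ge0 => t _; rewrite lee_fin sqr_ge0.
rewrite cov_mx_zero_mean //; apply/matrixP => i j; rewrite !mxE.
have [->|ij] := eqVneq i j; last first.
  have := std_normal_flip i (measurable_funM (measurable_coord Q2 i)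
    (measurable_coord Q2 j)) (integrable_coordM Q2 i j).
  under eq_Rintegral do rewrite /= !flipE eqxx eq_sym (negbTE ij) mulNr -mulN1r.
  rewrite RintegralZl //; last exact: integrable_coordM.
  by rewrite mulr0n; lra.
rewrite mulr1n; congr fine.
rewrite -(std_normal_coord j (f := fun t => (t ^+ 2)%:E)) //.
- by apply/measurable_EFinP; apply: measurable_funX.
- by move=> t; rewrite lee_fin sqr_ge0.
Qed.

End std_normal_moments.

(** * Moments and independence of Gaussian vectors *)

Section affine_images.
Context {R : realType} {d} {T : measurableType d} (P : probability T R).

Lemma square_integrable_mulmx m n (X : T -> 'cV[R]_n) (L : 'M[R]_(m, n)) :
  square_integrable P X -> square_integrable P (fun w => L *m X w).
Proof.
move=> X2; split=> [|a]; first exact: measurable_fun_mulmx X2.1.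
apply: (eq_integrable _ (fun w => \sum_i \sum_j
    (L a i * L a j)%:E * (X w i ord0 * X w j ord0)%:E)%E) => //.
  move=> w _; rewrite expr2 !mxE big_distrlr /= -sumEFin; apply: eq_bigr => i _.
  by rewrite -sumEFin; apply: eq_bigr => j _; rewrite -EFinM mulrACA.
apply: integrable_sum => // i _; apply: integrable_sum => // j _.
by apply: integrableZl => //; exact: integrable_coordM.
Qed.

Lemma square_integrable_shift n (X : T -> 'cV[R]_n) (mu : 'cV[R]_n) :
  square_integrable P X -> square_integrable P (fun w => mu + X w).
Proof.
move=> X2; split=> [|a].
  by apply: measurable_fun_addmx => //; exact: X2.1.
have i1 : P.-integrable setT (cst ((2 * mu a ord0 ^+ 2)%:E) : T -> \bar R).
  exact: finite_measure_integrable_cst.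
have i2 : P.-integrable setT (fun w => 2%:E * (X w a ord0 ^+ 2)%:E)%E.
  by apply: integrableZl => //; exact: X2.2.
apply: (le_integrable _ _ _ (integrableD measurableT i1 i2)) => //.
  apply/measurable_EFinP; apply: measurable_funX.
  by under eq_fun do rewrite mxE; apply: measurable_funD => //;
     exact: measurable_coord X2 a.
move=> w _ /=; rewrite lee_fin mxE ger0_norm ?sqr_ge0 //.
rewrite ger0_norm; last by rewrite addr_ge0 // mulr_ge0 // sqr_ge0.
move: (mu a ord0) (X w a ord0) => s t.
by have := sqr_ge0 (s - t); rewrite sqrrB sqrrD !mulr2n; lra.
Qed.

End affine_images.

Section gaussian_vectors.
Context {R : realType} {d} {T : measurableType d} (P : probability T R).
Context {n : nat} (X : T -> 'cV[R]_n).
Hypotheses (mX : measurable_fun setT X) (Xg : gaussian P X) (X0 :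
  zero_mean P X).

Lemma gaussian_mulmx m (L : 'M[R]_(m, n)) : gaussian P (fun w => L *m X w).
Proof.
have [q [Q [mu [A [Qstd QE]]]]] := Xg.
exists q, Q, (L *m mu), (L *m A); split=> // B mB.
transitivity (P (X @^-1` (mulmx L @^-1` B))); first by [].
rewrite QE; last exact: (measurable_preimage (measurable_mulmx L) mB).
by congr (Q _); apply/seteqP; split=> z /=; rewrite mulmxDr mulmxA.
Qed.

(** Integrals of functions of [X] are computed under [Q] through the affine map [Y]. The zero mean
    forces [mu = 0], and the covariance [v] of the normal vector passes through [A]. *)
Lemma gaussian_second_order :
  exists m (Q : probability 'cV[R]_m R) (A : 'M[R]_(n, m)) (v : R),
    [/\ std_normal_law Q, 0 <= v, cov_mx P X X = v *: (A *m A^T),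
        square_integrable P X &
        forall B, measurable B -> P (X @^-1` B) = Q [set z | B (A *m z)]].
Proof.
have [m [Q [mu [A [Qstd QE]]]]] := Xg.
have Q2 := std_normal_square_integrable Qstd.
have Q0 := std_normal_zero_mean Qstd.
have [v v0 Qv] := std_normal_cov Qstd.
pose Y (z : 'cV[R]_m) := mu + A *m z.
have Y2 : square_integrable Q Y.
  exact: (square_integrable_shift mu (square_integrable_mulmx A Q2)).
have transfer0 (f : 'cV[R]_n -> \bar R) : measurable_fun setT f ->
    (forall y, 0 <= f y)%E -> (\int[P]_w f (X w) = \int[Q]_z f (Y z))%E.
  move=> mf f0; transitivity (\int[image_law mX P]_y f y)%E.
    by rewrite ge0_integral_pushforward.
  transitivity (\int[image_law Y2.1 Q]_y f y)%E; last first.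
    by rewrite ge0_integral_pushforward //; exact: Y2.1.
  by apply: eq_measure_integral => B mB _; exact: QE.
have transferi (f : 'cV[R]_n -> R) : measurable_fun setT f ->
    Q.-integrable setT (fun z => (f (Y z))%:E) ->
    P.-integrable setT (fun w => (f (X w))%:E).
  move=> mf /integrableP[_ fi]; apply/integrableP; split.
    by apply/measurable_EFinP; exact: measurableT_comp mf mX.
  rewrite (transfer0 (fun y => `|(f y)%:E|)%E) //.
  by apply: measurableT_comp => //; exact/measurable_EFinP.
have transfer (f : 'cV[R]_n -> R) : measurable_fun setT f ->
    Q.-integrable setT (fun z => (f (Y z))%:E) ->
    (\int[P]_w (f (X w))%:E = \int[Q]_z (f (Y z))%:E)%E.
  move=> mf fi; have Pfi := transferi _ mf fi.
  transitivity (\int[image_law mX P]_y (f y)%:E)%E.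
    by rewrite integral_pushforward //; exact/measurable_EFinP.
  transitivity (\int[image_law Y2.1 Q]_y (f y)%:E)%E; last first.
    by rewrite integral_pushforward //; exact/measurable_EFinP.
  by apply: eq_measure_integral => B mB _; exact: QE.
have X2 : square_integrable P X.
  split=> // i; apply: (transferi (fun y => y i ord0 ^+ 2)); last exact: Y2.2.
  by apply: measurable_funX; exact: measurable_entry.
have mu0 : mu = 0.
  apply/matrixP => i j; rewrite (ord1 j) mxE; have := X0 i.
  rewrite unlock (transfer (fun y => y i ord0)); last 2 first.
  - exact: measurable_entry.
  - exact: (integrable_coord Y2).
  have A0 := zero_mean_mulmx Q2 A Q0 i; move: A0; rewrite unlock => A0.
  have iA := integrable_coord (square_integrable_mulmx A Q2) i.
  under eq_integral do rewrite mxE EFinD.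
  rewrite integralD //; last exact: finite_measure_integrable_cst.
  by rewrite A0 adde0 integral_cst // [X in (_ * X)%E]probability_setT mule1 =>
    -[].
exists m, Q, A, v; split=> //; last first.
  move=> B mB; rewrite QE // mu0; congr (Q _).
  by apply/seteqP; split=> z /=; rewrite add0r.
rewrite -[RHS](_ : A *m v%:M *m A^T = _); last first.
  by rewrite mul_mx_scalar -scalemxAl.
rewrite -Qv -cov_mx_mulmx // !cov_mx_zero_mean //; try exact: zero_mean_mulmx.
apply/matrixP => i j; rewrite !mxE; congr fine.
rewrite (transfer (fun y => y i ord0 * y j ord0)); last 2 first.
- by apply: measurable_funM; exact: measurable_entry.
- exact: (integrable_coordM Y2).
by apply: eq_integral => z _; rewrite /Y mu0 add0r.
Qed.

Lemma gaussian_square_integrable : square_integrable P X.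
Proof. by have [m [Q [A [v []]]]] := gaussian_second_order. Qed.

Lemma gaussian_gram : exists q (B : 'M[R]_(n, q)), cov_mx P X X = B *m B^T.
Proof.
have [m [Q [A [v [_ v0 -> _ _]]]]] := gaussian_second_order.
exists m, (Num.sqrt v *: A); rewrite linearZ /= -scalemxAl -scalemxAr scalerA.
by rewrite -expr2 sqr_sqrtr.
Qed.

(** Zero correlation makes the rows of [L A] orthogonal to those of [K A]. After a rotation they use
    disjoint coordinates, which are independent. *)
Lemma gaussian_uncorrelated_indep p q (L : 'M[R]_(p, n)) (K : 'M[R]_(q, n))
    (V : set 'cV[R]_p) (W : set 'cV[R]_q) :
  cov_mx P X X \in unitmx -> L *m cov_mx P X X *m K^T = 0 ->
  measurable V -> measurable W ->
  P ([set w | V (L *m X w)] `&` [set w | W (K *m X w)]) =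
  (P [set w | V (L *m X w)] * P [set w | W (K *m X w)])%E.
Proof.
have [m [Q [A [v [Qstd v0 CE _ QE]]]]] := gaussian_second_order.
move=> Cu LK mV mW.
have LAKA : (L *m A) *m (K *m A)^T = 0.
  (* If [v = 0], then [C = 0] is invertible, which forces [L = 0]. *)
  have [v00|v_neq0] := eqVneq v 0.
    have -> : L = 0 by rewrite -[L](mulmxK Cu) CE v00 scale0r mulmx0 mul0mx.
    by rewrite !mul0mx.
  apply: (scalerI v_neq0); rewrite scaler0 -LK CE trmx_mul !mulmxA.
  by rewrite -scalemxAr -scalemxAl !mulmxA.
have [U [I [rU LI KI]]] := normal_rotation_split LAKA.
have [Q' Q'std QQ'] := rU.2 Q Qstd.
have mL := @measurable_mulmx R p n 1 L; have mK := @measurable_mulmx R q n 1 K.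
(* A matrix whose columns outside [J] vanish does not notice the mask. *)
have maskEq (J : pred 'I_m) r (M : 'M[R]_(r, n)) z :
    (forall a k, ~~ J k -> (M *m A *m U) a k = 0) ->
    M *m (A *m (U *m z)) = (M *m A *m U) *m (mask J *m z) :> 'cV_r.
  move=> MJ; rewrite !mulmxA -!(mulmxA (M *m A)) !mulmxA.
  apply/matrixP => a b; rewrite -(mulmxA (M *m A *m U)) mxE [RHS]mxE.
  apply: eq_bigr => k _; rewrite maskE; case: ifP => // /negbT Jk.
  by rewrite MJ // !mul0r.
pose VL := [set y : 'cV[R]_n | V (L *m y)];
  pose WK := [set y : 'cV[R]_n | W (K *m y)].
have mVL : measurable VL by exact: (measurable_preimage mL).
have mWK : measurable WK by exact: (measurable_preimage mK).
have PE B : measurable B -> P (X @^-1` B) = Q' [set z | B (A *m (U *m z))].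
  move=> mB; rewrite QE // QQ' //.
  exact: (measurable_preimage (@measurable_mulmx R n m 1 A)).
have := PE _ (measurableI _ _ mVL mWK); rewrite [X @^-1` _]/= => ->.
have := PE _ mVL; rewrite [X @^-1` _]/= => ->.
have := PE _ mWK; rewrite [X @^-1` _]/= => ->.
pose V' := [set y : 'cV[R]_m | V ((L *m A *m U) *m y)].
pose W' := [set y : 'cV[R]_m | W ((K *m A *m U) *m y)].
have mV' : measurable V' by exact: (measurable_preimage (@measurable_mulmx R p m
  1 _)).
have mW' : measurable W' by exact: (measurable_preimage (@measurable_mulmx R q m
  1 _)).
have -> : [set z | VL (A *m (U *m z))] = [set z | V' (mask I *m z)].
  by apply/seteqP; split=> z; rewrite /VL /V' /= (maskEq I).
have KI' b k : ~~ predC I k -> (K *m A *m U) b k = 0.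
  by rewrite negbK => /KI.
have WE : [set z | WK (A *m (U *m z))] = [set z | W' (mask (predC I) *m z)].
  by apply/seteqP; split=> z; rewrite /WK /W' /= (maskEq (predC I)).
rewrite WE -(std_normal_mask_indep I Q'std mV' mW'); congr (Q' _).
rewrite -WE; apply/seteqP; split=> z /=; rewrite /VL /V' /= (maskEq I) //.
Qed.

End gaussian_vectors.

(** * Regular conditional distributions *)

Section conditional_integral.
Context {R : realType} {dT} {T : measurableType dT} (P : probability T R) {d :
  nat}.
Variables (G : set (set T)) (X : T -> 'cV[R]_d).
Hypotheses (GT : G `<=` measurable) (mX : measurable_fun setT X).
Local Open Scope ereal_scope.

Lemma sub_sigma_measurable (C : set T) : <<s G >> C -> measurable C.
Proof. by apply: smallest_sub => //; exact: sigma_algebra_measurable. Qed.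

Import HBNNSimple.

(** The definition is the case of indicators; it extends to simple functions by linearity and to [f]
    by monotone convergence. *)
Lemma cond_distribution_integral
    (k : R.-pker g_sigma_algebraType G ~> 'cV[R]_d) (C : set T)
    (mC : measurable C) (f : 'cV[R]_d -> \bar R) :
  is_cond_distribution P X k -> <<s G >> C ->
  measurable_fun setT f -> (forall y, 0 <= f y) ->
  \int[P]_(w in C) \int[k w]_y f y =
  \int[image_measure mX (mrestr P mC)]_y f y.
Proof.
move=> kX GC mf f0.
have mk B : measurable B -> measurable_fun [set: T] (fun w : T => k w B).
  by move=> mB _ D mD; apply: sub_sigma_measurable;
    exact: (measurable_kernel k B mB).
have mki (g : 'cV[R]_d -> \bar R) : measurable_fun setT g -> (forall y,
  0 <= g y) ->
    measurable_fun [set: T] (fun w : T => \int[k w]_y g y).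
  move=> mg g0; have mkg : measurable_fun [set: g_sigma_algebraType G]
      (fun w : g_sigma_algebraType G => \int[k w]_y g y).
    by apply: measurable_fun_integral_kernel => // U mU;
      exact: (measurable_kernel k U mU).
  by move=> _ B mB; apply: sub_sigma_measurable; exact: mkg.
have simple (h : {nnsfun 'cV[R]_d >-> R}) :
    \int[P]_(w in C) \int[k w]_y (h y)%:E =
    \int[image_measure mX (mrestr P mC)]_y (h y)%:E.
  transitivity (\int[P]_(w in C)
      (\sum_(r \in range h) r%:E * k w (h @^-1` [set r]))).
    by apply: eq_integral => w _; rewrite integralT_nnsfun sintegralE.
  rewrite integralT_nnsfun sintegralE ge0_integral_fsum //; last 2 first.
  - by move=> r; apply: measurable_funeM; apply: measurable_funTS; exact: mk.
  - by move=> r w _; exact: nnsfun_mulemu_ge0.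
  apply: eq_fsbigr => r _.
  have mr : measurable (h @^-1` [set r]) by [].
  have [r0|r0] := leP 0%R r.
    rewrite ge0_integralZl //; last by apply: measurable_funTS; exact: mk.
    by rewrite kX //= /pushforward /mrestr setIC.
  rewrite preimage_nnfun0 // measure0 mule0 integral0_eq // => w _.
  by rewrite measure0 mule0.
pose h := nnsfun_approx measurableT mf.
have hf y : f y = lim ((h n y)%:E @[n --> \oo]).
  by apply/esym/cvg_lim => //; exact: cvg_nnsfun_approx.
have hE n y : 0 <= (h n y)%:E by rewrite lee_fin.
have hnd y : {homo (fun n => (h n y)%:E) : a b / (a <= b)%N >-> a <= b}.
  by move=> a b ab; rewrite lee_fin; exact/lefP/nd_nnsfun_approx.
have mh n : measurable_fun setT (fun y => (h n y)%:E) by exact/measurable_EFinP.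
transitivity (\int[P]_(w in C) lim ((\int[k w]_y (h n y)%:E) @[n --> \oo])).
  apply: eq_integral => w _; rewrite -monotone_convergence //.
  by apply: eq_integral => y _; rewrite hf.
rewrite monotone_convergence //; last 3 first.
- by move=> n; apply: measurable_funTS; exact: mki.
- by move=> n w _; apply: integral_ge0 => y _.
- by move=> w _ a b ab; apply: ge0_le_integral => // y _; exact: hnd.
transitivity (lim ((\int[image_measure mX (mrestr P mC)]_y (h n y)%:E) @[n -->
  \oo])).
  by congr (lim _); apply/funext => A /=; under eq_fun do rewrite simple.
rewrite -monotone_convergence //.
by apply: eq_integral => y _; rewrite hf.
Qed.

(** Both conditional integrals are measurable for [<<s G>>] and have the same finite integrals over
    its events. *)
Lemma cond_distribution_unique
    (k k' : R.-pker g_sigma_algebraType G ~> 'cV[R]_d) (f : 'cV[R]_d ->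
      \bar R) :
  is_cond_distribution P X k -> is_cond_distribution P X k' ->
  measurable_fun setT f -> (forall y, 0 <= f y) ->
  \int[P]_w f (X w) < +oo ->
  {ae P, forall w : T, \int[k w]_y f y = \int[k' w]_y f y}.
Proof.
move=> kX k'X mf f0 fX.
(* The image of [P] under this identity is [P] restricted to [<<s G>>], whose null sets are null in
   [T]. *)
have mid : measurable_fun setT (id : T -> g_sigma_algebraType G).
  by move=> _ B mB; rewrite setTI; exact: sub_sigma_measurable.
have mki (l : R.-pker g_sigma_algebraType G ~> 'cV[R]_d) :
    measurable_fun [set: g_sigma_algebraType G] (fun w => \int[l w]_y f y).
  by apply: measurable_fun_integral_kernel => // U mU;
    exact: (measurable_kernel l U mU).
have kE (l : R.-pker g_sigma_algebraType G ~> 'cV[R]_d) (C :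
  set (g_sigma_algebraType G)) :
    measurable C -> \int[image_law mid P]_(w in C) (\int[l w]_y f y) =
    \int[P]_(w in C) (\int[l w]_y f y).
  move=> mC; rewrite ge0_integral_pushforward //.
    by apply: measurable_funTS; exact: mki.
  by move=> w _; exact: integral_ge0.
have : ae_eq (image_law mid P) setT
    (fun w => \int[k w]_y f y) (fun w => \int[k' w]_y f y).
  apply: integral_ae_eq => //.
    apply/integrableP; split; first exact: mki.
    under eq_integral do rewrite gee0_abs ?integral_ge0 //.
    rewrite kE // (cond_distribution_integral measurableT kX _ mf f0);
      last first.
      exact: (@measurableT _ (g_sigma_algebraType G)).
    rewrite (_ : integral _ _ _ = \int[image_law mX P]_y f y).
      by rewrite ge0_integral_pushforward.
    apply: eq_measure_integral => B mB _.
    by rewrite /= /pushforward /mrestr setIT.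
  move=> C _ mC; have mC' := sub_sigma_measurable mC.
  by rewrite !kE // (cond_distribution_integral mC' kX) //
    (cond_distribution_integral mC' k'X).
move=> [N [mN N0 NP]]; exists N; split; [exact: sub_sigma_measurable|exact:
  N0|].
by move=> w /= Hw; apply: NP => /=; apply: contra_not Hw => /(_ I).
Qed.

End conditional_integral.

Section shift_kernel.
Context {R : realType} {dT} {T : measurableType dT} (P : probability T R) {d :
  nat}.
Variables (G : set (set T)) (c r : T -> 'cV[R]_d).
Hypothesis GT : G `<=` measurable.
Hypothesis mc : measurable_fun [set: g_sigma_algebraType G]
  (c : g_sigma_algebraType G -> 'cV[R]_d).
Hypothesis mr : measurable_fun setT r.

Lemma measurable_shift (w : g_sigma_algebraType G) :
  measurable_fun setT (fun v : T => c w + r v).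
Proof. by apply: measurable_fun_addmx. Qed.

(** [w] is frozen inside [c] and only [r] is random: the explicit candidate for the conditional law
    of [c + r]. *)
Definition shift_law (w : g_sigma_algebraType G) :
    {measure set 'cV[R]_d -> \bar R} :=
  image_law (measurable_shift w) P.

Lemma measurable_shift_law U : measurable U ->
  measurable_fun [set: g_sigma_algebraType G] (fun w => shift_law w U).
Proof.
move=> mU; pose A := [set ab : 'cV[R]_d * 'cV[R]_d | U (ab.1 + ab.2)].
have mA : measurable A.
  apply: (measurable_preimage (f := fun ab : 'cV[R]_d * 'cV[R]_d =>
    ab.1 + ab.2)) => //.
  exact: measurable_fun_addmx.
have -> : (fun w => shift_law w U) =
    (fun a => image_law mr P (xsection A a)) \o (c : g_sigma_algebraType G ->
      'cV[R]_d).
  apply/funext => w /=; congr (P _); apply/seteqP; split=> v /=;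
  by rewrite /xsection /= in_setE.
by apply: measurableT_comp mc; exact: measurable_fun_xsection.
Qed.

HB.instance Definition _ :=
  isKernel.Build _ _ (g_sigma_algebraType G) 'cV[R]_d R shift_law
    measurable_shift_law.

Let shift_lawT w : shift_law w setT = 1%E.
Proof. exact: (probability_setT (image_law (measurable_shift w) P)). Qed.

HB.instance Definition _ :=
  Kernel_isProbability.Build _ _ (g_sigma_algebraType G) 'cV[R]_d R shift_law
    shift_lawT.

Definition shift_kernel : R.-pker g_sigma_algebraType G ~> 'cV[R]_d :=
  shift_law.

Hypothesis indep : forall C B, <<s G >> C -> measurable B ->
  P (C `&` r @^-1` B) = (P C * P (r @^-1` B))%E.

(** Independence makes the joint law of the point seen in [<<s G>>] and of [r] a product;
    integrating the sections of [A] gives the claim. *)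
Lemma shift_kernel_cond_distribution :
  is_cond_distribution P (fun w => c w + r w) shift_kernel.
Proof.
move=> C B GC mB.
have mid : measurable_fun setT (id : T -> g_sigma_algebraType G).
  by move=> _ D mD; rewrite setTI; exact: (sub_sigma_measurable GT mD).
have midr : measurable_fun setT (fun w : T => (w, r w) :
  g_sigma_algebraType G * 'cV[R]_d).
  exact: measurable_fun_pair.
pose A := [set wy : g_sigma_algebraType G * 'cV[R]_d | C wy.1 /\ B (c wy.1 +
  wy.2)].
have mA : measurable A.
  apply: measurableI.
    exact: (measurable_preimage (f := fst : g_sigma_algebraType G * 'cV[R]_d ->
      _) measurable_fst).
  apply: (measurable_preimage (f := fun wy : g_sigma_algebraType G * 'cV[R]_d =>
    c wy.1 + wy.2)) => //.
  apply: measurable_fun_addmx => //.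
  exact: (measurableT_comp mc measurable_fst).
have -> : P (C `&` (fun w => c w + r w) @^-1` B) = image_law midr P A by [].
rewrite -(product_measure_unique (m1 := image_law mid P) (m2 :=
  image_law mr P)) //.
rewrite /product_measure1.
transitivity (\int[image_law mid P]_(w in C) shift_law w B)%E.
  rewrite ge0_integral_pushforward //.
  by apply: measurable_funTS; exact: measurable_shift_law.
rewrite integral_mkcond; apply: eq_integral => w _; rewrite patchE.
case: ifPn; rewrite ?inE ?notin_setE => Cw.
  congr (P _); apply/seteqP; split=> v /=; rewrite /xsection /= in_setE /A /=;
    [by split|by case].
rewrite /= (_ : xsection A w = set0) ?measure0 //.
by apply/seteqP; split=> v //=; rewrite /xsection /= in_setE /A /= => -[].
Qed.

End shift_kernel.

Section conditional_mean.
Context {R : realType} {dT} {T : measurableType dT} (P : probability T R) {d :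
  nat}.
Variables (G : set (set T)) (c r : T -> 'cV[R]_d).
Hypothesis GT : G `<=` measurable.
Hypothesis mc : measurable_fun [set: g_sigma_algebraType G]
  (c : g_sigma_algebraType G -> 'cV[R]_d).
Hypotheses (r2 : square_integrable P r) (r0 : zero_mean P r).
Hypothesis cr2 : square_integrable P (fun w => c w + r w).
Hypothesis indep : forall C B, <<s G >> C -> measurable B ->
  P (C `&` r @^-1` B) = (P C * P (r @^-1` B))%E.

Lemma shift_kernel_mean w b :
  (\int[shift_kernel P mc r2.1 w]_y (y b ord0)%:E = (c w b ord0)%:E)%E.
Proof.
have iw : P.-integrable setT (cst (c w b ord0)%:E : T -> \bar R).
  exact: finite_measure_integrable_cst.
have ir := integrable_coord r2 b.
have icr : P.-integrable setT (fun v => ((c w + r v) b ord0)%:E).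
  apply: (eq_integrable _ (fun v => (c w b ord0)%:E + (r v b ord0)%:E)%E) => //.
    by move=> v _; rewrite mxE.
  exact: integrableD.
rewrite integral_pushforward //=; last 2 first.
- by apply: measurable_fun_addmx => //; exact: r2.1.
- by apply/measurable_EFinP; exact: measurable_entry.
rewrite preimage_setT.
under eq_integral do rewrite mxE EFinD.
rewrite integralD // (integral_cst P measurableT (c w b ord0)%:E) //.
rewrite [X in (_ * X)%E]probability_setT mule1.
by have := r0 b; rewrite unlock => ->; rewrite adde0.
Qed.

(** By uniqueness [k] can be replaced by the shift kernel, separately on the positive and negative
    parts of the coordinate. *)
Lemma cond_distribution_mean (k : R.-pker g_sigma_algebraType G ~> 'cV[R]_d) b :
  is_cond_distribution P (fun w => c w + r w) k ->
  {ae P, forall w : T, (\int[k w]_y (y b ord0)%:E = (c w b ord0)%:E)%E}.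
Proof.
move=> kX; have sX := shift_kernel_cond_distribution GT mc r2.1 indep.
pose f (y : 'cV[R]_d) := (y b ord0)%:E.
have mf : measurable_fun setT f by apply/measurable_EFinP;
  exact: measurable_entry.
have /integrableP[_ iX] := integrable_coord cr2 b.
have Xlt (g : 'cV[R]_d -> \bar R) : measurable_fun setT g ->
    (forall y, 0 <= g y)%E -> (forall y, g y <= `|f y|)%E ->
    (\int[P]_w g (c w + r w)%R < +oo)%E.
  move=> mg g0 gf; apply: le_lt_trans iX; apply: ge0_le_integral => //.
  - exact: (measurableT_comp mg cr2.1).
  - by apply: measurableT_comp => //; exact: (measurableT_comp mf cr2.1).
have mfp : measurable_fun setT f^\+%E by exact: measurable_funepos.
have mfn : measurable_fun setT f^\-%E by exact: measurable_funeneg.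
have ae_pos := cond_distribution_unique GT cr2.1 kX sX mfp (funepos_ge0 f).
have ae_neg := cond_distribution_unique GT cr2.1 kX sX mfn (funeneg_ge0 f).
have fp y : (f^\+ y <= `|f y|)%E.
  by rewrite funeposE /f /= -EFin_max lee_fin ge_max ler_norm normr_ge0.
have fn y : (f^\- y <= `|f y|)%E.
  by rewrite funenegE /f /= -EFin_max lee_fin ge_max -normrN ler_norm normr_ge0.
apply: filterS2 (ae_pos (Xlt _ mfp (funepos_ge0 f) fp)) (ae_neg (Xlt _ mfn
  (funeneg_ge0 f) fn)).
move=> w pE nE; rewrite -(shift_kernel_mean w b).
by rewrite integralE [RHS]integralE; congr (_ - _)%E.
Qed.

End conditional_mean.

Lemma eq_cond_distribution_mean {R : realType} {dT} {T : measurableType dT}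
    (P : probability T R) {d : nat} (G1 G2 : set (set T))
    (X c1 r1 c2 r2 : T -> 'cV[R]_d)
    (m1 : measurable_fun [set: g_sigma_algebraType G1] (c1 :
      g_sigma_algebraType G1 -> _))
    (m2 : measurable_fun [set: g_sigma_algebraType G2] (c2 :
      g_sigma_algebraType G2 -> _)) :
  G1 `<=` measurable -> G2 `<=` measurable ->
  square_integrable P X ->
  square_integrable P r1 -> square_integrable P r2 ->
  zero_mean P r1 -> zero_mean P r2 ->
  X = (fun w => c1 w + r1 w) -> X = (fun w => c2 w + r2 w) ->
  (forall C B, <<s G1 >> C -> measurable B ->
    P (C `&` r1 @^-1` B) = (P C * P (r1 @^-1` B))%E) ->
  (forall C B, <<s G2 >> C -> measurable B ->
    P (C `&` r2 @^-1` B) = (P C * P (r2 @^-1` B))%E) ->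
  eq_cond_distribution P X G1 G2 ->
  {ae P, forall w, c1 w = c2 w}.
Proof.
move=> G1T G2T X2 s1 s2 z1 z2 X1E X2E i1 i2 [k1 [k2 [kX1 kX2 k12]]].
have e1 b := cond_distribution_mean G1T m1 s1 z1 (eq_ind _ _ X2 _ X1E) i1 b
  (eq_ind _ (fun Y => is_cond_distribution P Y k1) kX1 _ X1E).
have e2 b := cond_distribution_mean G2T m2 s2 z2 (eq_ind _ _ X2 _ X2E) i2 b
  (eq_ind _ (fun Y => is_cond_distribution P Y k2) kX2 _ X2E).
have : {ae P, forall w, forall b, c1 w b ord0 = c2 w b ord0}.
  apply: filter_forall => b; apply: filterS3 (e1 b) (e2 b) k12 => w w1 w2 kw.
  apply: EFin_inj; rewrite -w1 -w2.
  by apply: eq_measure_integral => B mB _; exact: kw.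
by apply: filterS => w w12; apply/matrixP => i j; rewrite (ord1 j).
Qed.

(** * Conditional independence in a Gaussian sequence *)

Section blocks_of_sequence.
Context {R : realType} {N d : nat}.
Local Notation n := (\sum_(k < N.+1) d)%N.

Definition block (k : 'I_N.+1) : 'M[R]_(d, n) :=
  \mxrow_(j < N.+1) ((j == k)%:R%:M : 'M[R]_d).

Lemma block_mxcol m (Z : 'I_N.+1 -> 'M[R]_(d, m)) k :
  block k *m \mxcol_(j < N.+1) Z j = Z k.
Proof.
rewrite mul_mxrow_mxcol (bigD1 k) //= eqxx mul1mx big1 ?addr0 // =>
  j /negbTE ->.
by rewrite mul_scalar_mx scale0r.
Qed.

Lemma block_tr j k : block j *m (block k)^T = (j == k)%:R%:M.
Proof. by rewrite tr_mxrow block_mxcol tr_scalar_mx. Qed.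

End blocks_of_sequence.

Section bridge.
Context {R : realType} {dT} {T : measurableType dT} {P : probability T R} {N d :
  nat}.
Variables (x : 'I_N.+1 -> {RV P >-> 'cV[R]_d}) (xG : ZMNG x).
Local Notation X := (stacked x).
Local Notation C := (cov_mx P (stacked x) (stacked x)).
Local Notation E := (@block R N d).

Lemma blockX k w : E k *m X w = x k w.
Proof. exact: (block_mxcol (fun k => x k w)). Qed.

Lemma measurable_stacked : measurable_fun setT X.
Proof.
apply: measurable_fun_mx => i j; under eq_fun do rewrite mxE.
exact: (measurableT_comp (measurable_entry _ _) (measurable_funPT (x _))).
Qed.

Lemma comboX M w : combo E M *m X w = \sum_i M i *m x i w.
Proof. by rewrite mulmx_suml; apply: eq_bigr => i _;
  rewrite -mulmxA blockX. Qed.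

Let Xg : gaussian P X. Proof. by case: xG. Qed.
Let X0 : zero_mean P X. Proof. by case: xG. Qed.
Let Cu : C \in unitmx. Proof. by case: xG. Qed.
Let mX := measurable_stacked.
Let X2 := gaussian_square_integrable mX Xg X0.

Lemma generated_by_measurable S : generated_by x S `<=` measurable.
Proof.
move=> _ [i Si [B mB <-]]; rewrite setTI.
by rewrite -[X in measurable X]setTI; exact:
  (measurable_funPT (x i)) measurableT _ mB.
Qed.

Lemma combo_measurable (S : set 'I_N.+1) M : (forall i, ~ S i -> M i = 0) ->
  measurable_fun [set: g_sigma_algebraType (generated_by x S)]
    ((fun w => combo E M *m X w) : g_sigma_algebraType (generated_by x S) -> _).
Proof.
move=> M0; apply: measurable_fun_mx => a b.
under eq_fun do rewrite comboX summxE.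
apply: measurable_sum => i; have [Si|Si] := pselect (S i); last first.
  under eq_fun do rewrite M0 // mul0mx mxE.
  exact: measurable_cst.
apply: (measurableT_comp (measurable_entry a b)).
apply: measurable_fun_mulmx => _ B mB; apply: sub_sigma_algebra.
by exists i => //; exists B.
Qed.

(** Every [x_i] with [i] in [S] is a function of the single vector [K X], so each generated event is
    an event about [K X], which is uncorrelated with [L X]. *)
Lemma orthogonal_indep (S : set 'I_N.+1) (L : 'M[R]_(d, _)) :
  (forall i, S i -> L *m C *m (E i)^T = 0) ->
  forall D B, <<s generated_by x S >> D -> measurable B ->
  P (D `&` (fun w => L *m X w) @^-1` B) =
  (P D * P ((fun w => L *m X w) @^-1` B))%E.
Proof.
move=> LE D B GD mB.
pose K := \sum_(i | `[< S i >]) (E i)^T *m E i.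
have KT : K^T = K.
  by rewrite /K raddf_sum; apply: eq_bigr => j _ /=; rewrite trmx_mul trmxK.
have EK i : S i -> E i *m K = E i.
  move=> Si; rewrite mulmx_sumr [LHS](bigD1 i) /=; last exact/asboolP.
  rewrite mulmxA block_tr eqxx mul1mx [X in _ + X]big1 ?addr0 // =>
    j /andP[_ ji].
  by rewrite mulmxA block_tr eq_sym (negbTE ji) mul_scalar_mx scale0r.
have LK : K *m C *m L^T = 0.
  have [q [A CE]] := gaussian_gram mX Xg X0.
  suff LCK : L *m C *m K = 0.
    by move/(congr1 trmx): LCK; rewrite 2!trmx_mul (gram_sym CE) KT trmx0
      mulmxA.
  rewrite mulmx_sumr; apply: big1 => i /asboolP Si.
  by rewrite mulmxA LE // mul0mx.
have [V mV <-] : (preimage_set_system setT (fun w => K *m X w) measurable) D.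
  move: D GD; apply: smallest_sub.
    exact/sigma_algebra_preimage/sigma_algebra_measurable.
  move=> _ [i Si [W mW <-]]; exists [set y | W (E i *m y)].
    exact: (measurable_preimage (measurable_mulmx (E i))).
  by rewrite !setTI; apply/seteqP; split=> w /=; rewrite mulmxA EK // blockX.
rewrite setTI.
exact: (gaussian_uncorrelated_indep mX Xg X0 Cu LK mV mB).
Qed.

(** The same [c] and [r] give shift kernels for both sigma-algebras: [c] is measurable for the
    smaller one, and [r] is independent of the larger one. *)
Lemma lin_markov_cond k (S1 S2 : set 'I_N.+1) M : S2 `<=` S1 ->
  lin_markov E C k S1 S2 M ->
  eq_cond_distribution P (x k) (generated_by x S1) (generated_by x S2).
Proof.
move=> S21 [M0 MC]; pose r w := (E k - combo E M) *m X w.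
have mr : measurable_fun setT r by exact: measurable_fun_mulmx.
have M0' i : ~ S1 i -> M i = 0 by move=> S1i; apply: M0 => /S21.
pose c w := combo E M *m X w.
have xE : (x k : T -> _) = (fun w => c w + r w).
  by apply/funext => w; rewrite /c /r mulmxBl addrC subrK blockX.
exists (shift_kernel P (combo_measurable M0') mr).
exists (shift_kernel P (combo_measurable M0) mr);
  rewrite [X in is_cond_distribution _ X]xE; split.
- apply: shift_kernel_cond_distribution; first exact: generated_by_measurable.
  exact: orthogonal_indep.
- apply: shift_kernel_cond_distribution; first exact: generated_by_measurable.
  by apply: orthogonal_indep => i /S21; exact: MC.
- by apply: aeW.
Qed.

(** The two best predictors are conditional means, hence equal almost surely. Their difference [L X]
    has zero covariance, so [L C = 0] and the error on [S2] is orthogonal to all of [S1]. *)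
Lemma cond_lin_markov k (S1 S2 : set 'I_N.+1) : S2 `<=` S1 ->
  eq_cond_distribution P (x k) (generated_by x S1) (generated_by x S2) ->
  exists M, lin_markov E C k S1 S2 M.
Proof.
move=> S21 k12; have [q [A CE]] := gaussian_gram mX Xg X0.
have [M1 [M10 M1C]] := lin_markov_exists CE block_tr k S1.
have [M2 [M20 M2C]] := lin_markov_exists CE block_tr k S2.
exists M2; split => // i S1i.
pose r M w := (E k - combo E M) *m X w.
have r2 M : square_integrable P (r M) by exact: square_integrable_mulmx.
have r0 M : zero_mean P (r M) by exact: zero_mean_mulmx.
have xE M : (x k : T -> _) = (fun w => combo E M *m X w + r M w).
  by apply/funext => w; rewrite /r mulmxBl addrC subrK blockX.
have x2 : square_integrable P (x k).
  have -> : (x k : T -> _) = (fun w => E k *m X w).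
    by apply/funext => w; rewrite blockX.
  exact: square_integrable_mulmx.
have cc : {ae P, forall w, combo E M1 *m X w = combo E M2 *m X w}.
  apply: (eq_cond_distribution_mean (combo_measurable M10) (combo_measurable
    M20)
    (@generated_by_measurable S1) (@generated_by_measurable S2) x2 (r2 M1) (r2
      M2)
    (r0 M1) (r0 M2) (xE M1) (xE M2)) k12.
  - exact: orthogonal_indep.
  - exact: orthogonal_indep.
pose L := combo E M1 - combo E M2.
have L0 : {ae P, forall w, L *m X w = (0 : 'M[R]_(d, _)) *m X w}.
  by apply: filterS cc => w cw; rewrite mul0mx mulmxBl cw subrr.
have mL K : measurable_fun setT (fun w => (K : 'M[R]_(d, _)) *m X w).
  exact: measurable_fun_mulmx.
have := cov_mx_ae (mL L) (mL 0) (mL L) (mL 0) L0 L0.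
rewrite !cov_mx_mulmx // mul0mx mul0mx => /(gram_isotropic CE) LC.
have -> : E k - combo E M2 = (E k - combo E M1) + L by rewrite /L addrA subrK.
by rewrite 2!mulmxDl LC mul0mx addr0 M1C.
Qed.

Lemma CM_lin_CM (k1 c : 'I_N.+1) : c = k1 \/ c = ord_max ->
  CM x k1 ord_max c <-> lin_CM E C k1 c.
Proof.
move=> cE; have sub (j : 'I_N.+1) : (k1 <= j)%N -> present c j `<=` past k1 c j.
  by move=> k1j i [->|->]; [left; rewrite k1j leqnn|right].
have [q [A CE]] := gaussian_gram mX Xg X0.
split=> [[short|xCM]|xCM]; last 2 first.
- move=> j k k1j jk; apply: cond_lin_markov; first exact: sub.
  by apply: xCM => //; rewrite -ltnS.
- right=> j k k1j jk _; have [M] := xCM j k k1j jk.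
  by apply: lin_markov_cond; exact: sub.
move=> j k k1j jk.
(* On a short interval the linear condition holds automatically: either the target is a conditioning
   variable, or past and present coincide. *)
have [ck|ck] := eqVneq c k; first by apply: lin_markov_self; right.
suff pp (i : 'I_N.+1) : past k1 c j i -> present c j i.
  have [M [M0 MC]] := lin_markov_exists CE block_tr k (past k1 c j).
  by exists M; split => // i iP; apply: M0 => /pp.
move=> [/andP[k1i ij]|->]; last by right.
have kN : (k <= N)%N by rewrite -ltnS.
have [ji|ij'] := leqP j i; first by left; apply/val_inj/eqP;
  rewrite eqn_leq ij ji.
(* Now [k1 <= i < j < k <= N] and [N - k1 <= 2]. For [c = k1] this leaves [i = k1]; for [c = N],
   where [k < N], it is impossible. *)
case: cE => cE.
  right; rewrite cE; apply/val_inj/eqP; rewrite eqn_leq k1i andbT.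
  by move: short => /=; lia.
have : (k < N)%N.
  rewrite ltn_neqAle kN andbT; apply: contra ck => /eqP kE.
  by rewrite cE; apply/eqP/val_inj.
by move: short => /=; lia.
Qed.

End bridge.

Theorem proposition3p5 (R : realType) (dT : measure_display)
    (T : measurableType dT) (P : probability T R) (N d : nat) (N_gt0 : (0 < N)%N)
    (k1 : 'I_N.+1) (x : 'I_N.+1 -> {RV P >-> 'cV[R]_d}) (x_ZMNG : ZMNG x) :
  (CM_L x ord0 ord_max /\ CM_F x k1 ord_max) <->
  exists (G : 'I_N.+1 -> 'I_N.+1 -> 'M[R]_d)
         (e : 'I_N.+1 -> {RV P >-> 'cV[R]_d}),
    [/\ white_nonsingular_gaussian e,
        forall j k : 'I_N.+1, k = j.+1 :> nat -> (k < N)%N ->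
          {ae P, forall w,
             x k w = G k j *m x j w + G k ord_max *m x ord_max w + e k w},
        {ae P, forall w, x ord_max w = e ord_max w},
        {ae P, forall w, x ord0 w = G ord0 ord_max *m x ord_max w + e ord0 w} &
        forall k l : 'I_N.+1, (k1 < k)%N -> l = k.+1 :> nat -> (l < N)%N ->
          invmx (cov_mx P (e k) (e k)) *m G k ord_max =
          (G l k)^T *m invmx (cov_mx P (e l) (e l)) *m G l ord_max].
Proof.
have [xg x0 Cu] := x_ZMNG; have mX := measurable_stacked x.
have X2 := gaussian_square_integrable mX xg x0.
have [q [A CE]] := gaussian_gram mX xg x0.
have mL (K : 'M[R]_(d, _)) : measurable_fun setT (fun w => K *m stacked x w).
  exact: measurable_fun_mulmx.
have -> : CM_L x ord0 ord_max <-> lin_CM (@block R N d) (cov_mx P (stacked x)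
  (stacked x)) ord0 ord_max.
  by apply: CM_lin_CM => //; right.
have -> : CM_F x k1 ord_max <-> lin_CM (@block R N d) (cov_mx P (stacked x)
  (stacked x)) k1 k1.
  by apply: CM_lin_CM => //; left.
split=> [[xL xF]|[G [e [eW rec recN rec0 eB]]]].
  have [G [L [[rec recN rec0] [Lo Lu] LB]]] :=
    lin_CM_model N_gt0 (@block_tr R N d) CE Cu xL xF.
  (* The noises are linear images of the stacked sequence, so the matrix identities hold
     pointwise. *)
  pose e k : {RV P >-> 'cV[R]_d} := to_mfun (mL (L k)).
  have eC j k : cov_mx P (e j) (e k) = L j *m cov_mx P (stacked x) (stacked x)
    *m (L k)^T.
    exact: cov_mx_mulmx.
  exists G, e; split.
  - split.
    + have -> : stacked e = (fun w => (\mxcol_k L k) *m stacked x w).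
        by apply/funext => w; rewrite mxcol_mul.
      exact: gaussian_mulmx.
    + by move=> k; exact: zero_mean_mulmx.
    + by move=> j k jk; rewrite eC Lo.
    + by move=> k; rewrite eC.
  - move=> j k kj kN; apply: aeW => w.
    by rewrite -!(blockX x) (rec j k kj kN) !mulmxDl !mulmxA.
  - by apply: aeW => w; rewrite -blockX recN.
  - by apply: aeW => w; rewrite -!(blockX x) rec0 mulmxDl mulmxA.
  - by move=> k l k1k lk lN; rewrite !eC; exact: LB.
pose E := @block R N d.
(* Conversely, the recursion is solved for each noise as a linear image of the stacked sequence; the
   two end indices differ because [0 < N]. *)
pose L (k : 'I_N.+1) : 'M[R]_(d, _) := if k == ord0 then E ord0 - G ord0 ord_max
  *m E ord_max
  else if k == ord_max then E ord_max
  else E k - (G k (inord k.-1) *m E (inord k.-1) + G k ord_max *m E ord_max).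
have L0 : L ord0 = E ord0 - G ord0 ord_max *m E ord_max by rewrite /L eqxx.
have LN : L ord_max = E ord_max.
  by rewrite /L eqxx; case: eqP => // /(congr1 val) /= N0; rewrite N0 in N_gt0.
have LS (j k : 'I_N.+1) : k = j.+1 :> nat -> (k < N)%N ->
    L k = E k - (G k j *m E j + G k ord_max *m E ord_max).
  move=> kj kN; rewrite /L; case: eqP => [k0|_]; first by rewrite k0 in kj.
  case: eqP => [kE|_]; first by rewrite kE ltnn in kN.
  have kE : k.-1 = j :> nat by rewrite kj.
  by have -> : inord k.-1 = j by apply/val_inj; rewrite /= kE inordK.
have eL k : {ae P, forall w, e k w = L k *m stacked x w}.
  have [k0|k_gt0] := posnP k.
    have -> : k = ord0 by apply/val_inj.
    by apply: filterS rec0 => w xw; rewrite L0 mulmxBl -mulmxA !blockX xw addrC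
      addKr.
  case: (ltnP k N) => [kN|Nk]; last first.
    have -> : k = ord_max by apply/val_inj/eqP;
      rewrite eqn_leq Nk -ltnS ltn_ord.
    by apply: filterS recN => w xw; rewrite LN blockX xw.
  pose j : 'I_N.+1 := inord k.-1.
  have kj : k = j.+1 :> nat by rewrite inordK prednK // ltnW.
  apply: filterS (rec j k kj kN) => w xw.
  by rewrite (LS j k) // mulmxBl mulmxDl -!mulmxA !blockX xw addrC addKr.
(* The noises agree with these linear images almost surely, which determines their covariances. *)
have eC j k : cov_mx P (e j) (e k) = L j *m cov_mx P (stacked x) (stacked x) *m
  (L k)^T.
  rewrite -cov_mx_mulmx //; apply: cov_mx_ae => //.
have [_ _ eo eu] := eW.
have Lm : model E G L.
  split=> [j k kj kN||]; first by rewrite (LS j k) // addrC subrK.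
  - by rewrite LN.
  - by rewrite L0 addrC subrK.
have Lw : white (cov_mx P (stacked x) (stacked x)) L.
  by split=> [j k jk|k]; [rewrite -eC eo|rewrite -eC].
split; first exact: (model_lin_CM_L (@block_tr R N d) CE Lm Lw).
apply: (model_lin_CM_F (@block_tr R N d) CE Lm Lw) => k l k1k lk lN.
by rewrite -!eC; exact: eB.
Qed.
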